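(* Let $m,N\in\mathbb{N}=\{1,2,3,\dots\}$ and let $f(z)=z+\sum_{n=2}^{\infty}a_nz^n\in\mathcal{C}$ (with $a_1=1$), $\Omega=f(\mathbb{D})$. Then $$|f(z^m)|+\sum_{n=N}^{\infty}|a_n||z|^n\le d(0,\partial\Omega)$$ holds for $|z|=r\le r_0$, where $r_0$ is the unique positive root of the equation $$3r^m-1+2r^N\left(\frac{1-r^m}{1-r}\right)=0.$$ The radius $r_0$ is sharp.
   Context: $\mathbb{D}=\{z\in\mathbb{C}:|z|<1\}$. $\mathcal{C}$ is the class of univalent convex functions: analytic $f(z)=z+\sum_{n\ge2}a_nz^n$ on $\mathbb{D}$ with $1+zf''(z)/f'(z)\prec(1+z)/(1-z)$, i.e. $\Re(1+zf''(z)/f'(z))>0$ on $\mathbb{D}$. $d(0,\partial\Omega)$ is the Euclidean distance from $0$ to the boundary of $\Omega$. ''Sharp'' means that $r_0$ cannot be replaced by a larger number so that the inequality still holds for all $f\in\mathcal{C}$. *)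

(* Defs.v *)
From Stdlib Require Import Reals.
From Coquelicot Require Import Coquelicot.

Open Scope R_scope.

Definition unit_disk (z : C) : Prop := Cmod z < 1.

Definition image (f : C -> C) (A : C -> Prop) (w : C) : Prop :=
  exists z : C, A z /\ f z = w.

Definition boundary (A : C -> Prop) (w : C) : Prop :=
  forall eps : R, 0 < eps ->
    (exists u : C, A u /\ Cmod (u - w)%C < eps) /\
    (exists v : C, ~ A v /\ Cmod (v - w)%C < eps).

(* The value is p_infty when A is empty. *)
Definition dist_to_set (z : C) (A : C -> Prop) : Rbar :=
  Glb_Rbar (fun d : R => exists w : C, A w /\ d = Cmod (w - z)%C).

(* f is analytic on the unit disk, f(z) = z + a_2 z^2 + a_3 z^3 + ... there,
   and Re (1 + z f''(z) / f'(z)) > 0 on the disk.  The functions f1 and f2 are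
   the complex derivatives f' and f'' on the disk.  Since x / 0 is a junk value
   here, f' <> 0 has to be stated for the quotient to make sense.  Univalence of
   f is a consequence of these conditions and is not part of the definition.
   The values of f outside the disk are irrelevant. *)
Definition convex_class (f : C -> C) (a : nat -> C) : Prop :=
  a 0%nat = RtoC 0 /\ a 1%nat = RtoC 1 /\
  (forall z : C, unit_disk z ->
     @is_pseries C_AbsRing C_NormedModule a z (f z)) /\
  exists f1 f2 : C -> C, forall z : C, unit_disk z ->
    @is_derive C_AbsRing C_NormedModule f z (f1 z) /\
    @is_derive C_AbsRing C_NormedModule f1 z (f2 z) /\
    f1 z <> RtoC 0 /\
    0 < Re (1 + z * f2 z / f1 z)%C.

(* The sum over n >= N of |a_n| r^n.  For f in the class and r < 1 the series
   converges, so Series is its actual sum. *)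
Definition coef_tail (a : nat -> C) (N : nat) (r : R) : R :=
  Series (fun k : nat => Cmod (a (N + k)%nat) * r ^ (N + k)).

Definition bohr_inequality (m N : nat) (f : C -> C) (a : nat -> C) (z : C) : Prop :=
  Rbar_le (Finite (Cmod (f (z ^ m)%C) + coef_tail a N (Cmod z)))
          (dist_to_set (RtoC 0) (boundary (image f unit_disk))).

(* The points z range over the domain of f; the radius r itself may exceed 1. *)
Definition bohr_holds_up_to (m N : nat) (r : R) : Prop :=
  forall (f : C -> C) (a : nat -> C), convex_class f a ->
  forall z : C, unit_disk z -> Cmod z <= r -> bohr_inequality m N f a z.

(* At r = 1 the quotient is 0/0, which evaluates to 0 here, so the left-hand side
   is 2 (by continuity it would be 2 + 2 m): r = 1 is not a root in either reading. *)
Definition radius_equation (m N : nat) (r : R) : Prop :=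
  3 * r ^ m - 1 + 2 * r ^ N * ((1 - r ^ m) / (1 - r)) = 0.

(* Main.v *)
(* For f in the class, |a_n| <= 1 and f(D) contains the disk |w| < 1/2.  Hence the left-hand
   side is at most r^m / (1 - r^m) + r^N / (1 - r) while the distance is at least 1/2, and the
   former is <= 1/2 exactly when the left-hand side of the radius equation is <= 0; since the
   quotient (1 - r^m) / (1 - r) is 1 + r + ... + r^(m-1), that expression is increasing in r.
   For f(z) = z / (1 - z) all these bounds are equalities.

   Everything about f comes from p = 1 + z f'' / f', which has positive real part.
   Caratheodory's bound |p_n| <= 2, inserted in (z f')' = p f', gives |a_n| <= 1.  The Schwarz
   lemma for (p - 1) / (p + 1) gives |f'(z)| >= (1 + |z|)^(-2), and minimising
   |f(z) - w| + s |z| / (1 + |z|) with s close to 1 then solves f(z) = w for |w| < 1/2, without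
   using univalence.  Both bounds on p rest on a maximum principle that needs only second-order
   Taylor expansions. *)

Require Import Defs.
From Stdlib Require Import Reals Lra Lia ClassicalEpsilon.
From Coquelicot Require Import Coquelicot.

(** * Maxima on closed disks *)

(** Division by powers of z is done on coefficients rather than on functions: a Taylor remainder
    divided by z^n is again a power series, and the Schwarz lemma is stated for the quotient, with
    the weight |z|^n in its hypothesis, so that no removable singularity arises. For the same reason
    p = (z f')' / f' is never expanded as an infinite series: at each order, a polynomial plus z^n
    times an explicit quotient is enough. The maximum principle asks for two complex derivatives and
    is applied to expressions containing f'', so the derivatives supplied with the class do not
    reach far enough. Therefore f is replaced by its coefficient series [CPS a], which can be
    differentiated termwise any number of times. The constant 1/2 is the integral of (1 + t)^(-2)
    over [0, 1]. The primitive t / (1 + t) is the penalty in the minimisation because its slope is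
    exactly the lower bound for |f'|; the factor s < 1 makes the gain of a Newton step strict. *)

Lemma Cmod_minus_sym (a b : C) : Cmod (a - b)%C = Cmod (b - a)%C.
Proof. rewrite <- Cmod_opp. f_equal. ring. Qed.

Lemma Cmod_minus_le (a b : C) : Cmod (a - b)%C <= Cmod a + Cmod b.
Proof. unfold Cminus. rewrite <- (Cmod_opp b). apply Cmod_triangle. Qed.

Lemma Cmod_minus_ge (a b : C) : Cmod a - Cmod b <= Cmod (a - b)%C.
Proof.
  assert (H := Cmod_triangle (a - b)%C b).
  replace (a - b + b)%C with a in H by ring. lra.
Qed.

Lemma Cmod_le_Re_Im (z : C) : Cmod z <= Rabs (Re z) + Rabs (Im z).
Proof.
  assert (H := Cmod2_alt z). assert (H1 := Cmod_ge_0 z).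
  rewrite <- (pow2_abs (Re z)), <- (pow2_abs (Im z)) in H.
  assert (H2 := Rabs_pos (Re z)). assert (H3 := Rabs_pos (Im z)). nra.
Qed.

Lemma Im_le_Cmod (z : C) : Rabs (Im z) <= Cmod z.
Proof.
  assert (H := Cmod2_alt z). assert (H1 := Cmod_ge_0 z).
  rewrite <- (pow2_abs (Im z)) in H. assert (H3 := Rabs_pos (Im z)). nra.
Qed.

Lemma Re_le_Cmod (z : C) : Re z <= Cmod z.
Proof. eapply Rle_trans; [apply Rle_abs | apply re_le_Cmod]. Qed.

Lemma bounded_cluster_point_R (u : nat -> R) (M : R) :
  (forall n, Rabs (u n) <= M) ->
  exists l, forall eps, 0 < eps -> forall N, exists n, (N <= n)%nat /\ Rabs (u n - l) < eps.
Proof.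
  intros HM.
  destruct (Bolzano_Weierstrass u (fun x => - M <= x <= M)) as [l Hl].
  - apply compact_P3.
  - intros n. specialize (HM n). apply Rabs_le_between in HM. exact HM.
  - exists l. intros eps He N.
    destruct (Hl (disc l (mkposreal eps He)) N) as [p [Hp1 Hp2]].
    + exists (mkposreal eps He). intros x Hx. exact Hx.
    + exists p. split; assumption.
Qed.

(** The indices [s k] are chosen so that the real parts converge along them; a cluster point of the
    imaginary parts along [s] then completes the limit. *)
Lemma bounded_cluster_point (u : nat -> C) (M : R) :
  (forall n, Cmod (u n) <= M) ->
  exists l, forall eps, 0 < eps -> forall N,
    exists n, (N <= n)%nat /\ Cmod (u n - l)%C < eps.
Proof.
  intros HM.
  destruct (bounded_cluster_point_R (fun n => Re (u n)) M) as [x Hx].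
  { intros n. eapply Rle_trans; [apply re_le_Cmod | apply HM]. }
  assert (Hs : forall k, exists n, (k <= n)%nat /\ Rabs (Re (u n) - x) < / (INR k + 1)).
  { intros k. apply Hx. apply Rinv_0_lt_compat. assert (H := pos_INR k). lra. }
  apply choice in Hs. destruct Hs as [s Hs].
  destruct (bounded_cluster_point_R (fun n => Im (u (s n))) M) as [y Hy].
  { intros n. eapply Rle_trans; [apply Im_le_Cmod | apply HM]. }
  exists (x, y). intros eps He N.
  destruct (archimed_cor1 (eps / 2)) as [K [HK1 HK2]]; [lra|].
  destruct (Hy (eps / 2) ltac:(lra) (N + K)%nat) as [n [Hn1 Hn2]].
  destruct (Hs n) as [Hs1 Hs2].
  exists (s n). split; [lia|].
  eapply Rle_lt_trans; [apply Cmod_le_Re_Im|].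
  assert (E1 : Re (u (s n) - (x, y))%C = Re (u (s n)) - x) by reflexivity.
  assert (E2 : Im (u (s n) - (x, y))%C = Im (u (s n)) - y) by reflexivity.
  rewrite E1, E2.
  assert (/ (INR n + 1) <= / INR K).
  { apply Rinv_le_contravar. apply lt_0_INR; lia.
    assert (H := le_INR K n ltac:(lia)). lra. }
  lra.
Qed.

Definition continuous_at (G : C -> R) (z : C) : Prop :=
  forall eps, 0 < eps -> exists delta, 0 < delta /\
    forall w, Cmod (w - z)%C < delta -> Rabs (G w - G z) < eps.

(* Composing with [atan] makes the supremum finite from the start. *)
Lemma closed_disk_max (G : C -> R) (rho : R) :
  0 <= rho ->
  (forall z, Cmod z <= rho -> continuous_at G z) ->
  exists z0, Cmod z0 <= rho /\ forall z, Cmod z <= rho -> G z <= G z0.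
Proof.
  intros Hr HG.
  set (E := fun y => exists z, Cmod z <= rho /\ y = atan (G z)).
  destruct (completeness E) as [S [HS1 HS2]].
  { exists (PI / 2). intros y [z [_ ->]]. left. apply atan_bound. }
  { exists (atan (G (RtoC 0))). exists (RtoC 0). rewrite Cmod_0. split; [lra|reflexivity]. }
  assert (Hz : forall n : nat, exists z, Cmod z <= rho /\ S - / (INR n + 1) < atan (G z)).
  { intros n. apply NNPP. intros Hn.
    assert (Hp : 0 < / (INR n + 1)).
    { apply Rinv_0_lt_compat. assert (H := pos_INR n). lra. }
    assert (S <= S - / (INR n + 1)); [|lra].
    apply HS2. intros y [z [Hz ->]].
    destruct (Rle_lt_dec (atan (G z)) (S - / (INR n + 1))) as [H|H]; [exact H|].
    exfalso. apply Hn. exists z. split; assumption. }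
  apply choice in Hz. destruct Hz as [u Hu].
  destruct (bounded_cluster_point u rho (fun n => proj1 (Hu n))) as [l Hl].
  assert (Hlr : Cmod l <= rho).
  { apply le_epsilon. intros e He. destruct (Hl e He 0%nat) as [n [_ Hn]].
    assert (H1 := proj1 (Hu n)). rewrite Cmod_minus_sym in Hn.
    assert (H2 := Cmod_minus_ge l (u n)). lra. }
  exists l. split; [exact Hlr|]. intros z Hz.
  assert (HSl : S <= atan (G l)).
  { apply le_epsilon. intros e He.
    destruct (derivable_continuous_pt atan (G l) (derivable_pt_atan (G l)) (e / 2))
      as [d1 [Hd1 Hc]]; [lra|].
    destruct (HG l Hlr d1 Hd1) as [d2 [Hd2 Hc2]].
    destruct (archimed_cor1 (e / 2)) as [K [HK1 HK2]]; [lra|].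
    destruct (Hl d2 Hd2 K) as [n [Hn1 Hn2]].
    assert (Hn3 := proj2 (Hu n)).
    assert (/ (INR n + 1) <= / INR K).
    { apply Rinv_le_contravar. apply lt_0_INR; lia.
      assert (H := le_INR K n ltac:(lia)). lra. }
    specialize (Hc2 _ Hn2).
    (* [continuity_pt] only speaks of points different from the base point, so equal values are
       treated apart. *)
    destruct (Req_dec (G (u n)) (G l)) as [Heq|Hne].
    - rewrite <- Heq. lra.
    - specialize (Hc (G (u n))). simpl in Hc. unfold R_dist in Hc.
      assert (Hc' : Rabs (atan (G (u n)) - atan (G l)) < e / 2).
      { apply Hc. split; [|exact Hc2]. split; [exact I|]. intros H1. apply Hne. auto. }
      apply Rabs_def2 in Hc'. lra. }
  destruct (Rle_lt_dec (G z) (G l)) as [H|H]; [exact H|].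
  apply atan_increasing in H.
  assert (atan (G z) <= S) by (apply HS1; exists z; auto). lra.
Qed.

(** * Complex derivatives *)

(** The product form of differentiability: without a quotient the case w = z is not exceptional, and
    Lipschitz bounds can be read off directly. *)
Definition cderiv (f : C -> C) (z l : C) : Prop :=
  forall eps, 0 < eps -> exists delta, 0 < delta /\
    forall w, Cmod (w - z)%C < delta ->
      Cmod (f w - f z - (w - z) * l)%C <= eps * Cmod (w - z)%C.

Lemma is_derive_cderiv (f : C -> C) (z l : C) :
  @is_derive C_AbsRing C_NormedModule f z l <-> cderiv f z l.
Proof.
  split.
  - intros [_ H] eps He.
    specialize (H z (fun P HP => HP) (mkposreal eps He)).
    destruct H as [d Hd]. exists (pos d). split; [apply cond_pos|].
    intros w Hw. apply (Hd w). exact Hw.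
  - intros H. split.
    + apply is_linear_scal_l.
    + intros x Hx eps.
      (* [is_derive] asks for the estimate at every limit of the neighbourhood filter of [z]; the
         only such limit is [z]. *)
      apply (@is_filter_lim_locally_unique C_AbsRing (AbsRing_NormedModule C_AbsRing)) in Hx. subst x.
      destruct (H eps (cond_pos eps)) as [d [Hd Hw]].
      exists (mkposreal d Hd). intros w Hb. apply Hw. exact Hb.
Qed.

Lemma cderiv_const (c z : C) : cderiv (fun _ => c) z (RtoC 0).
Proof.
  intros eps He. exists 1. split; [lra|]. intros w _.
  replace (c - c - (w - z) * 0)%C with (RtoC 0) by ring. rewrite Cmod_0.
  apply Rmult_le_pos; [lra|apply Cmod_ge_0].
Qed.

Lemma cderiv_id (z : C) : cderiv (fun w => w) z (RtoC 1).
Proof.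
  intros e He. exists 1. split; [lra|]. intros v _.
  replace (v - z - (v - z) * 1)%C with (RtoC 0) by ring. rewrite Cmod_0.
  apply Rmult_le_pos; [lra|apply Cmod_ge_0].
Qed.

Lemma cderiv_scal_id (c z : C) : cderiv (fun w => c * w)%C z c.
Proof.
  intros eps He. exists 1. split; [lra|]. intros w _.
  replace (c * w - c * z - (w - z) * c)%C with (RtoC 0) by ring. rewrite Cmod_0.
  apply Rmult_le_pos; [lra|apply Cmod_ge_0].
Qed.

Lemma cderiv_plus (f g : C -> C) (z l k : C) :
  cderiv f z l -> cderiv g z k -> cderiv (fun w => f w + g w)%C z (l + k)%C.
Proof.
  intros Hf Hg eps He.
  destruct (Hf (eps / 2)) as [d1 [Hd1 H1]]; [lra|].
  destruct (Hg (eps / 2)) as [d2 [Hd2 H2]]; [lra|].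
  exists (Rmin d1 d2). split; [apply Rmin_pos; lra|]. intros w Hw.
  specialize (H1 w (Rlt_le_trans _ _ _ Hw (Rmin_l _ _))).
  specialize (H2 w (Rlt_le_trans _ _ _ Hw (Rmin_r _ _))).
  replace (f w + g w - (f z + g z) - (w - z) * (l + k))%C
    with ((f w - f z - (w - z) * l) + (g w - g z - (w - z) * k))%C by ring.
  eapply Rle_trans; [apply Cmod_triangle|]. lra.
Qed.

Lemma cderiv_lipschitz (f : C -> C) (z l : C) :
  cderiv f z l ->
  exists delta, 0 < delta /\ forall w, Cmod (w - z)%C < delta ->
    Cmod (f w - f z)%C <= (Cmod l + 1) * Cmod (w - z)%C.
Proof.
  intros Hf. destruct (Hf 1) as [d [Hd H]]; [lra|].
  exists d. split; [exact Hd|]. intros w Hw. specialize (H w Hw).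
  replace (f w - f z)%C with ((f w - f z - (w - z) * l) + (w - z) * l)%C by ring.
  eapply Rle_trans; [apply Cmod_triangle|]. rewrite Cmod_mult. lra.
Qed.

Lemma cderiv_continuous (f : C -> C) (z l : C) :
  cderiv f z l ->
  forall eps, 0 < eps -> exists delta, 0 < delta /\
    forall w, Cmod (w - z)%C < delta -> Cmod (f w - f z)%C < eps.
Proof.
  intros Hf eps He. destruct (cderiv_lipschitz _ _ _ Hf) as [d [Hd H]].
  assert (Hl := Cmod_ge_0 l).
  assert (Hq : 0 < eps / (Cmod l + 1)) by (apply Rdiv_lt_0_compat; lra).
  exists (Rmin d (eps / (Cmod l + 1))). split; [apply Rmin_pos; lra|].
  intros w Hw. specialize (H w (Rlt_le_trans _ _ _ Hw (Rmin_l _ _))).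
  assert (Hw2 := Rlt_le_trans _ _ _ Hw (Rmin_r _ _)).
  apply (Rmult_lt_compat_l (Cmod l + 1)) in Hw2; [|lra].
  replace ((Cmod l + 1) * (eps / (Cmod l + 1))) with eps in Hw2 by (field; lra). lra.
Qed.

Lemma cderiv_mult (f g : C -> C) (z l k : C) :
  cderiv f z l -> cderiv g z k ->
  cderiv (fun w => f w * g w)%C z (l * g z + f z * k)%C.
Proof.
  intros Hf Hg eps He.
  destruct (cderiv_lipschitz _ _ _ Hf) as [d1 [Hd1 H1]].
  set (A := Cmod (f z) + Cmod (g z) + Cmod l + 1 + 1).
  assert (HA : 0 < A).
  { unfold A. assert (Q1 := Cmod_ge_0 (f z)). assert (Q2 := Cmod_ge_0 (g z)).
    assert (Q3 := Cmod_ge_0 l). lra. }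
  assert (He3 : 0 < eps / (3 * A)) by (apply Rdiv_lt_0_compat; lra).
  destruct (Hf (eps / (3 * A)) He3) as [d2 [Hd2 H2]].
  destruct (Hg (eps / (3 * A)) He3) as [d3 [Hd3 H3]].
  destruct (cderiv_continuous _ _ _ Hg (eps / (3 * A)) He3) as [d4 [Hd4 H4]].
  exists (Rmin (Rmin d1 d2) (Rmin d3 d4)). split.
  { repeat apply Rmin_pos; assumption. }
  intros w Hw.
  assert (W12 := Rlt_le_trans _ _ _ Hw (Rmin_l _ _)).
  assert (W34 := Rlt_le_trans _ _ _ Hw (Rmin_r _ _)).
  specialize (H1 w (Rlt_le_trans _ _ _ W12 (Rmin_l _ _))).
  specialize (H2 w (Rlt_le_trans _ _ _ W12 (Rmin_r _ _))).
  specialize (H3 w (Rlt_le_trans _ _ _ W34 (Rmin_l _ _))).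
  specialize (H4 w (Rlt_le_trans _ _ _ W34 (Rmin_r _ _))).
  (* Two first-order errors and one product of increments; each is at most a third of eps |w - z|,
     which explains the 3 in [eps / (3 * A)]. *)
  replace (f w * g w - f z * g z - (w - z) * (l * g z + f z * k))%C
    with (g z * (f w - f z - (w - z) * l) + (f z * (g w - g z - (w - z) * k)
      + (f w - f z) * (g w - g z)))%C by ring.
  eapply Rle_trans; [apply Cmod_triangle|].
  eapply Rle_trans; [apply Rplus_le_compat_l, Cmod_triangle|].
  rewrite !Cmod_mult.
  set (e := eps / (3 * A)) in *.
  assert (Ee : eps = 3 * (A * e)) by (unfold e; field; lra).
  set (x := Cmod (w - z)%C) in *.
  assert (Hx : 0 <= x) by apply Cmod_ge_0.
  assert (Q1 := Cmod_ge_0 (f z)). assert (Q2 := Cmod_ge_0 (g z)). assert (Q3 := Cmod_ge_0 l).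
  assert (B1 : Cmod (g z) * Cmod (f w - f z - (w - z) * l)%C <= A * (e * x)).
  { apply Rmult_le_compat; try apply Cmod_ge_0; [unfold A; lra|exact H2]. }
  assert (B2 : Cmod (f z) * Cmod (g w - g z - (w - z) * k)%C <= A * (e * x)).
  { apply Rmult_le_compat; try apply Cmod_ge_0; [unfold A; lra|exact H3]. }
  assert (B3 : Cmod (f w - f z)%C * Cmod (g w - g z)%C <= (A * x) * e).
  { apply Rmult_le_compat; try apply Cmod_ge_0; [|lra].
    eapply Rle_trans; [exact H1|]. apply Rmult_le_compat_r; [exact Hx|unfold A; lra]. }
  rewrite Ee. lra.
Qed.

Lemma cderiv_inv (f : C -> C) (z l : C) :
  cderiv f z l -> f z <> RtoC 0 ->
  cderiv (fun w => / f w)%C z (- l / (f z * f z))%C.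
Proof.
  intros Hf Hz eps He.
  assert (Hz0 : 0 < Cmod (f z)) by (apply Cmod_gt_0; exact Hz).
  destruct (cderiv_lipschitz _ _ _ Hf) as [d1 [Hd1 H1]].
  assert (Q3 := Cmod_ge_0 l).
  set (m := Cmod (f z)) in *.
  set (L := Cmod l + 1) in *.
  assert (HL : 1 <= L) by (unfold L; lra).
  assert (Hm2 : 0 < m * m) by (apply Rmult_lt_0_compat; lra).
  assert (Hm3 : 0 < m * m * m) by (apply Rmult_lt_0_compat; lra).
  destruct (cderiv_continuous _ _ _ Hf (m / 2)) as [d2 [Hd2 H2]]; [lra|].
  destruct (Hf (eps * (m * m) / 2)) as [d3 [Hd3 H3]]; [nra|].
  (* Below [d4], the quadratic term L^2 |w - z|^2 / (m / 2) is at most eps m^2 |w - z| / 2; the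
     other half of the tolerance goes to the linear error of [f]. *)
  set (d4 := eps * (m * m * m) / (4 * (L * L))).
  assert (Hd4 : 0 < d4) by (apply Rdiv_lt_0_compat; nra).
  exists (Rmin (Rmin d1 d2) (Rmin d3 d4)). split.
  { repeat apply Rmin_pos; assumption. }
  intros w Hw.
  assert (W12 := Rlt_le_trans _ _ _ Hw (Rmin_l _ _)).
  assert (W34 := Rlt_le_trans _ _ _ Hw (Rmin_r _ _)).
  specialize (H1 w (Rlt_le_trans _ _ _ W12 (Rmin_l _ _))).
  specialize (H2 w (Rlt_le_trans _ _ _ W12 (Rmin_r _ _))).
  specialize (H3 w (Rlt_le_trans _ _ _ W34 (Rmin_l _ _))).
  assert (W4 := Rlt_le_trans _ _ _ W34 (Rmin_r _ _)).
  set (x := Cmod (w - z)%C) in *.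
  assert (Hx : 0 <= x) by apply Cmod_ge_0.
  assert (Hfw : m / 2 <= Cmod (f w)).
  { rewrite Cmod_minus_sym in H2. assert (H := Cmod_minus_ge (f z) (f w)).
    fold m in H. lra. }
  assert (Hw0 : f w <> RtoC 0) by (apply Cmod_gt_0; lra).
  replace (/ f w - / f z - (w - z) * (- l / (f z * f z)))%C
    with (((f w - f z) * (f w - f z) / f w - (f w - f z - (w - z) * l)) / (f z * f z))%C
    by (field; split; assumption).
  rewrite Cmod_div by (apply Cmult_neq_0; assumption).
  rewrite Cmod_mult. fold m.
  apply Rle_div_l; [exact Hm2|].
  eapply Rle_trans; [apply Cmod_minus_le|].
  rewrite Cmod_div, Cmod_mult by exact Hw0.
  assert (B : Cmod (f w - f z)%C * Cmod (f w - f z)%C / Cmod (f w) <= eps * (m * m) / 2 * x).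
  { apply Rle_div_l; [lra|].
    apply Rle_trans with ((L * x) * (L * x)).
    - apply Rmult_le_compat; try apply Cmod_ge_0; exact H1.
    - apply Rle_trans with (eps * (m * m) / 2 * x * (m / 2)).
      + assert (HH : L * L * x <= eps * (m * m * m) / 4).
        { unfold d4 in W4. apply (Rmult_lt_compat_l (L * L)) in W4; [|nra].
          replace (L * L * (eps * (m * m * m) / (4 * (L * L)))) with (eps * (m * m * m) / 4) in W4
            by (field; lra). lra. }
        apply (Rmult_le_compat_r x) in HH; [|exact Hx]. lra.
      + apply Rmult_le_compat_l; [|exact Hfw].
        apply Rmult_le_pos; [|exact Hx]. nra. }
  lra.
Qed.

Lemma cderiv_comp_scal (f : C -> C) (c z l : C) :
  cderiv f (c * z)%C l -> cderiv (fun w => f (c * w))%C z (c * l)%C.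
Proof.
  intros Hf eps He. assert (Hc := Cmod_ge_0 c).
  assert (He' : 0 < eps / (Cmod c + 1)) by (apply Rdiv_lt_0_compat; lra).
  destruct (Hf _ He') as [d [Hd H]].
  exists (d / (Cmod c + 1)). split; [apply Rdiv_lt_0_compat; lra|].
  intros w Hw.
  apply (Rmult_lt_compat_l (Cmod c + 1)) in Hw; [|lra].
  replace ((Cmod c + 1) * (d / (Cmod c + 1))) with d in Hw by (field; lra).
  assert (Hx := Cmod_ge_0 (w - z)%C).
  specialize (H (c * w)%C).
  replace (c * w - c * z)%C with (c * (w - z))%C in H by ring.
  rewrite Cmod_mult in H.
  replace (f (c * w) - f (c * z) - (w - z) * (c * l))%C
    with (f (c * w) - f (c * z) - c * (w - z) * l)%C by ring.
  eapply Rle_trans; [apply H; lra|].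
  replace (eps * Cmod (w - z)%C) with (eps / (Cmod c + 1) * ((Cmod c + 1) * Cmod (w - z)%C))
    by (field; lra).
  apply Rmult_le_compat_l; lra.
Qed.

Lemma cderiv_ext_loc (f g : C -> C) (z l : C) (d : R) :
  0 < d -> (forall w, Cmod (w - z)%C < d -> f w = g w) -> cderiv f z l -> cderiv g z l.
Proof.
  intros Hd Hfg Hf eps He. destruct (Hf eps He) as [d1 [Hd1 H1]].
  exists (Rmin d d1). split; [apply Rmin_pos; lra|]. intros w Hw.
  rewrite <- (Hfg w), <- (Hfg z).
  - apply H1. eapply Rlt_le_trans; [exact Hw|apply Rmin_r].
  - replace (z - z)%C with (RtoC 0) by ring. rewrite Cmod_0. exact Hd.
  - eapply Rlt_le_trans; [exact Hw|apply Rmin_l].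
Qed.

Lemma cderiv_unique (f : C -> C) (z l k : C) : cderiv f z l -> cderiv f z k -> l = k.
Proof.
  intros Hl Hk. apply Ceq_minus. apply Cmod_eq_0. apply Rle_antisym; [|apply Cmod_ge_0].
  apply le_epsilon. intros e He.
  destruct (Hl (e / 2)) as [d1 [Hd1 H1]]; [lra|].
  destruct (Hk (e / 2)) as [d2 [Hd2 H2]]; [lra|].
  set (t := Rmin d1 d2 / 2).
  assert (Hm : 0 < Rmin d1 d2) by (apply Rmin_pos; lra).
  assert (Ht : 0 < t) by (unfold t; lra).
  assert (Hw : Cmod (z + t - z)%C = t).
  { replace (z + t - z)%C with (RtoC t) by ring. rewrite Cmod_R. apply Rabs_pos_eq. lra. }
  specialize (H1 (z + t)%C). specialize (H2 (z + t)%C). rewrite Hw in H1, H2.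
  assert (A1 := Rmin_l d1 d2). assert (A2 := Rmin_r d1 d2).
  specialize (H1 ltac:(unfold t; lra)). specialize (H2 ltac:(unfold t; lra)).
  assert (Hb : Cmod (t * (l - k))%C <= e * t).
  { replace (t * (l - k))%C with ((f (z + t) - f z - (z + t - z) * k)
      - (f (z + t) - f z - (z + t - z) * l))%C by ring.
    eapply Rle_trans; [apply Cmod_minus_le|]. lra. }
  rewrite Cmod_mult, Cmod_R, Rabs_pos_eq in Hb by lra.
  apply (Rmult_le_reg_l t); lra.
Qed.

(** The factor [k] selects a real component: 1 gives the real part, [- Ci] the imaginary part, and
    the conjugate of an increment the component along that increment. Real one-variable calculus
    then applies along segments. *)
Lemma cderiv_path (h : C -> C) (z d k l : C) (t : R) :
  cderiv h (z + t * d)%C l ->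
  derivable_pt_lim (fun s => Re (h (z + s * d) * k)%C) t (Re (d * l * k)%C).
Proof.
  intros Hh eps He.
  assert (HK : 0 < Cmod d * Cmod k + 1).
  { assert (Q1 := Cmod_ge_0 d). assert (Q2 := Cmod_ge_0 k). nra. }
  destruct (Hh (eps / 2 / (Cmod d * Cmod k + 1))) as [d0 [Hd0 H]].
  { apply Rdiv_lt_0_compat; lra. }
  assert (Hd1 : 0 < d0 / (Cmod d + 1)).
  { apply Rdiv_lt_0_compat; [exact Hd0|]. assert (Q1 := Cmod_ge_0 d). lra. }
  exists (mkposreal _ Hd1). intros s Hs Hs2. cbv beta. change (Rabs s < d0 / (Cmod d + 1)) in Hs2.
  assert (Q1 := Cmod_ge_0 d). assert (Q2 := Cmod_ge_0 k).
  specialize (H (z + (t + s)%R * d)%C).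
  assert (Ew : (z + (t + s)%R * d - (z + t * d))%C = (s * d)%C).
  { rewrite RtoC_plus. ring. }
  rewrite Ew in H. rewrite Cmod_mult, Cmod_R in H.
  assert (Hs0 : 0 < Rabs s) by (apply Rabs_pos_lt; exact Hs).
  assert (Hlt : Rabs s * Cmod d < d0).
  { apply (Rmult_lt_compat_r (Cmod d + 1)) in Hs2; [|lra].
    replace (d0 / (Cmod d + 1) * (Cmod d + 1)) with d0 in Hs2 by (field; lra). lra. }
  specialize (H Hlt).
  set (X := (h (z + (t + s)%R * d) - h (z + t * d) - s * d * l)%C) in *.
  assert (E : (Re (h (z + (t + s)%R * d) * k)%C - Re (h (z + t * d) * k)%C) / s - Re (d * l * k)%C
    = Re (X * k)%C / s).
  { unfold X.
    replace ((h (z + (t + s)%R * d) - h (z + t * d) - s * d * l) * k)%C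
      with (h (z + (t + s)%R * d) * k + - (h (z + t * d) * k) + - (s * (d * l * k)))%C by ring.
    rewrite !re_plus, !re_opp, re_scal_l. field. exact Hs. }
  rewrite E. unfold Rdiv. rewrite Rabs_mult, Rabs_inv.
  apply (Rmult_lt_reg_r (Rabs s)); [exact Hs0|].
  rewrite Rmult_assoc, Rinv_l, Rmult_1_r by lra.
  eapply Rle_lt_trans; [apply re_le_Cmod|]. rewrite Cmod_mult.
  apply Rle_lt_trans with (eps / 2 / (Cmod d * Cmod k + 1) * (Rabs s * Cmod d) * Cmod k).
  { apply Rmult_le_compat_r; assumption. }
  replace (eps / 2 / (Cmod d * Cmod k + 1) * (Rabs s * Cmod d) * Cmod k)
    with (eps / 2 * Rabs s * (Cmod d * Cmod k / (Cmod d * Cmod k + 1))) by (field; lra).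
  assert (Cmod d * Cmod k / (Cmod d * Cmod k + 1) <= 1).
  { apply Rle_div_l; lra. }
  assert (0 < eps / 2 * Rabs s) by (apply Rmult_lt_0_compat; lra). nra.
Qed.

Lemma Cmult_conj_self (z : C) : (z * Cconj z)%C = RtoC (Cmod z ^ 2).
Proof. rewrite RtoC_pow, <- Cmod2_conj, RtoC_pow. reflexivity. Qed.

(* The real mean value theorem applied to [Re (h * conj (h (z + d) - h z))] along the segment. *)
Lemma cderiv_mean_value (h h1 : C -> C) (z d : C) (M : R) :
  (forall t, 0 <= t <= 1 ->
     cderiv h (z + t * d)%C (h1 (z + t * d)%C) /\ Cmod (h1 (z + t * d)%C) <= M) ->
  Cmod (h (z + d) - h z)%C <= M * Cmod d.
Proof.
  intros H. set (D := (h (z + d) - h z)%C).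
  destruct (MVT_cor2 (fun s => Re (h (z + s * d) * Cconj D)%C)
    (fun s => Re (d * h1 (z + s * d) * Cconj D)%C) 0 1 ltac:(lra)) as [c [Hc1 Hc2]].
  { intros c Hc. apply cderiv_path. apply H. exact Hc. }
  replace (z + 1 * d)%C with (z + d)%C in Hc1 by ring.
  replace (z + 0 * d)%C with z in Hc1 by ring.
  assert (E : Re (h (z + d) * Cconj D)%C - Re (h z * Cconj D)%C = Cmod D ^ 2).
  { rewrite <- re_RtoC at 1. rewrite <- (re_RtoC (Cmod D ^ 2)), <- Cmult_conj_self.
    unfold D at 3. rewrite re_RtoC. unfold Rminus. rewrite <- re_opp, <- re_plus.
    f_equal. ring. }
  rewrite E in Hc1.
  assert (HM : Re (d * h1 (z + c * d) * Cconj D)%C <= Cmod d * M * Cmod D).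
  { eapply Rle_trans; [apply Re_le_Cmod|]. rewrite !Cmod_mult, Cmod_conj.
    apply Rmult_le_compat_r; [apply Cmod_ge_0|].
    apply Rmult_le_compat_l; [apply Cmod_ge_0|]. apply H. lra. }
  assert (HD := Cmod_ge_0 D).
  destruct (Req_dec (Cmod D) 0) as [H0|H0].
  - rewrite H0. apply Rmult_le_pos; [|apply Cmod_ge_0].
    eapply Rle_trans; [apply Cmod_ge_0|]. apply (H 0). lra.
  - apply (Rmult_le_reg_r (Cmod D)); [lra|]. nra.
Qed.

(** The mean value inequality is applied to [h] minus its quadratic polynomial. The derivative of
    this difference is the linearisation error of [h1] at [z], so differentiability of [h1] at the
    single point [z] is enough. *)
Lemma cderiv_taylor2 (h h1 : C -> C) (z c2 : C) (r : R) :
  0 < r -> (forall w, Cmod (w - z)%C < r -> cderiv h w (h1 w)) -> cderiv h1 z c2 ->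
  forall eps, 0 < eps -> exists delta, 0 < delta /\ forall d, Cmod d < delta ->
    Cmod (h (z + d) - (h z + h1 z * d + c2 / 2 * (d * d)))%C <= eps * Cmod d ^ 2.
Proof.
  intros Hr H H1 eps He.
  destruct (H1 eps He) as [d0 [Hd0 Hb]].
  exists (Rmin d0 r). split; [apply Rmin_pos; lra|]. intros d Hd.
  set (G := fun w => (h w + (- (h1 z) * w + - (c2 / 2) * ((w + - z) * (w + - z))))%C).
  (* The unsimplified shape is what the sum and product rules return for [G]. *)
  set (G1 := fun w => (h1 w + (- (h1 z) + (0 * ((w + - z) * (w + - z))
     + - (c2 / 2) * (((1 + 0) * (w + - z)) + (w + - z) * (1 + 0)))))%C).
  assert (HG : Cmod (G (z + d) - G z)%C <= (eps * Cmod d) * Cmod d).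
  { apply cderiv_mean_value with (h1 := G1). intros t Ht.
    assert (Et : Cmod (z + t * d - z)%C <= Cmod d).
    { replace (z + t * d - z)%C with (t * d)%C by ring.
      rewrite Cmod_mult, Cmod_R, Rabs_pos_eq by lra.
      assert (Q := Cmod_ge_0 d). nra. }
    split.
    - unfold G, G1. apply cderiv_plus.
      + apply H. eapply Rle_lt_trans; [exact Et|].
        eapply Rlt_le_trans; [exact Hd|apply Rmin_r].
      + apply cderiv_plus; [apply cderiv_scal_id|].
        apply (cderiv_mult (fun _ => (- (c2 / 2))%C) (fun w => ((w + - z) * (w + - z))%C));
          [apply cderiv_const|].
        apply (cderiv_mult (fun w => (w + - z)%C) (fun w => (w + - z)%C));
          (apply cderiv_plus; [apply cderiv_id|apply cderiv_const]).
    - replace (G1 (z + t * d)%C) with (h1 (z + t * d) - h1 z - (z + t * d - z) * c2)%C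
        by (unfold G1; field).
      eapply Rle_trans; [apply Hb|].
      + eapply Rle_lt_trans; [exact Et|]. eapply Rlt_le_trans; [exact Hd|apply Rmin_l].
      + apply Rmult_le_compat_l; [lra|exact Et]. }
  replace (h (z + d) - (h z + h1 z * d + c2 / 2 * (d * d)))%C with (G (z + d) - G z)%C
    by (unfold G; ring).
  replace (eps * Cmod d ^ 2) with (eps * Cmod d * Cmod d) by ring. exact HG.
Qed.

(** * Maximum principle and Schwarz lemma *)

Lemma continuous_at_continuity (f : R -> R) (G : C -> R) (z : C) :
  continuity_pt f (G z) -> continuous_at G z -> continuous_at (fun w => f (G w)) z.
Proof.
  intros Hf HG eps He. destruct (Hf eps He) as [d1 [Hd1 H1]].
  destruct (HG d1 Hd1) as [d2 [Hd2 H2]].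
  exists d2. split; [exact Hd2|]. intros w Hw.
  destruct (Req_dec (G w) (G z)) as [E|E].
  - rewrite E, Rminus_diag, Rabs_R0. exact He.
  - apply (H1 (G w)). split; [split; [exact I|auto]|]. apply H2. exact Hw.
Qed.

Lemma continuous_at_plus (F G : C -> R) (z : C) :
  continuous_at F z -> continuous_at G z -> continuous_at (fun w => F w + G w) z.
Proof.
  intros HF HG eps He.
  destruct (HF (eps / 2)) as [d1 [Hd1 H1]]; [lra|].
  destruct (HG (eps / 2)) as [d2 [Hd2 H2]]; [lra|].
  exists (Rmin d1 d2). split; [apply Rmin_pos; lra|]. intros w Hw.
  specialize (H1 w (Rlt_le_trans _ _ _ Hw (Rmin_l _ _))).
  specialize (H2 w (Rlt_le_trans _ _ _ Hw (Rmin_r _ _))).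
  replace (F w + G w - (F z + G z)) with ((F w - F z) + (G w - G z)) by ring.
  eapply Rle_lt_trans; [apply Rabs_triang|]. lra.
Qed.

Lemma cderiv_continuous_Cmod (f : C -> C) (z l : C) :
  cderiv f z l -> continuous_at (fun w => Cmod (f w)) z.
Proof.
  intros Hf eps He. destruct (cderiv_continuous _ _ _ Hf eps He) as [d [Hd H]].
  exists d. split; [exact Hd|]. intros w Hw. specialize (H w Hw).
  assert (A1 := Cmod_minus_ge (f w) (f z)). assert (A2 := Cmod_minus_ge (f z) (f w)).
  rewrite Cmod_minus_sym in A2. apply Rabs_def1; lra.
Qed.

(** Exactly the regularity that gives second-order Taylor expansions, and stable under sums,
    products, inverses and rotations. *)
Definition hol2 (h : C -> C) : Prop :=
  exists h1 h2 : C -> C, forall z, unit_disk z ->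
    cderiv h z (h1 z) /\ cderiv h1 z (h2 z).

Lemma hol2_const (c : C) : hol2 (fun _ => c).
Proof.
  exists (fun _ => RtoC 0), (fun _ => RtoC 0). intros z _. split; apply cderiv_const.
Qed.

Lemma hol2_plus (f g : C -> C) : hol2 f -> hol2 g -> hol2 (fun z => f z + g z)%C.
Proof.
  intros [f1 [f2 Hf]] [g1 [g2 Hg]].
  exists (fun z => f1 z + g1 z)%C, (fun z => f2 z + g2 z)%C. intros z Hz.
  destruct (Hf z Hz), (Hg z Hz). split; apply cderiv_plus; assumption.
Qed.

Lemma hol2_mult (f g : C -> C) : hol2 f -> hol2 g -> hol2 (fun z => f z * g z)%C.
Proof.
  intros [f1 [f2 Hf]] [g1 [g2 Hg]].
  exists (fun z => f1 z * g z + f z * g1 z)%C.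
  exists (fun z => (f2 z * g z + f1 z * g1 z) + (f1 z * g1 z + f z * g2 z))%C.
  intros z Hz. destruct (Hf z Hz), (Hg z Hz).
  split; [|apply cderiv_plus]; apply cderiv_mult; assumption.
Qed.

Lemma hol2_inv (f : C -> C) :
  hol2 f -> (forall z, unit_disk z -> f z <> RtoC 0) -> hol2 (fun z => / f z)%C.
Proof.
  intros [f1 [f2 Hf]] Hn.
  exists (fun z => (- (1)) * f1 z * / (f z * f z))%C.
  eexists. intros z Hz. destruct (Hf z Hz) as [H1 H2]. specialize (Hn z Hz). split.
  - replace ((- (1)) * f1 z * / (f z * f z))%C with (- f1 z / (f z * f z))%C
      by (field; exact Hn).
    apply cderiv_inv; assumption.
  - apply (cderiv_mult (fun z => (- (1)) * f1 z)%C (fun z => / (f z * f z))%C z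
      (0 * f1 z + (- (1)) * f2 z)
      (- (f1 z * f z + f z * f1 z) / (f z * f z * (f z * f z)))).
    + apply (cderiv_mult (fun _ => (- (1))%C) f1); [apply cderiv_const|assumption].
    + apply (cderiv_inv (fun z => f z * f z)%C);
        [apply cderiv_mult; assumption|apply Cmult_neq_0; assumption].
Qed.

Lemma hol2_rotate (f : C -> C) (c : C) :
  Cmod c = 1 -> hol2 f -> hol2 (fun z => f (c * z))%C.
Proof.
  intros Hc [f1 [f2 Hf]].
  exists (fun z => c * f1 (c * z))%C, (fun z => 0 * f1 (c * z) + c * (c * f2 (c * z)))%C.
  intros z Hz. unfold unit_disk in *.
  destruct (Hf (c * z)%C) as [H1 H2]; [rewrite Cmod_mult, Hc; lra|].
  split.
  - apply cderiv_comp_scal. exact H1.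
  - apply (cderiv_mult (fun _ => c) (fun z => f1 (c * z))%C);
      [apply cderiv_const|]. apply cderiv_comp_scal. exact H2.
Qed.

(** Parseval's identity on the four points i^k t: the exponents 0, 1, 2 are distinct modulo 4, so
    all mixed terms cancel. *)
Lemma four_point_identity (a b c : C) (t : R) :
  Cmod (a + b * t + c * (t * t))%C ^ 2
  + Cmod (a + b * (Ci * t) + c * ((Ci * t) * (Ci * t)))%C ^ 2
  + Cmod (a + b * (- t) + c * ((- t) * (- t)))%C ^ 2
  + Cmod (a + b * (Ci * - t) + c * ((Ci * - t) * (Ci * - t)))%C ^ 2
  = 4 * (Cmod a ^ 2 + Cmod b ^ 2 * t ^ 2 + Cmod c ^ 2 * t ^ 4).
Proof.
  destruct a as [a1 a2], b as [b1 b2], c as [c1 c2].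
  rewrite !Cmod2_alt. simpl. ring.
Qed.

(* Strict subharmonicity: averaging over the four points [z0 + i^k t] kills the linear and
   quadratic terms of [psi] up to o(t^2), while [eta |z|^2] contributes [eta t^2]. *)
Lemma hol2_no_interior_max (psi : C -> C) (eta delta : R) (z0 : C) :
  hol2 psi -> unit_disk z0 -> 0 < eta -> 0 < delta ->
  (forall d, Cmod d < delta ->
     Cmod (psi (z0 + d)%C) ^ 2 + eta * Cmod (z0 + d)%C ^ 2
     <= Cmod (psi z0) ^ 2 + eta * Cmod z0 ^ 2) -> False.
Proof.
  intros [h1 [h2 Hh]] Hz0 Heta Hdelta Hmax. unfold unit_disk in *.
  set (a := psi z0) in *. set (b := h1 z0). set (c := (h2 z0 / 2)%C).
  set (K := Cmod a + Cmod b + Cmod c + 1).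
  assert (HK : 0 < K).
  { unfold K. assert (Q1 := Cmod_ge_0 a). assert (Q2 := Cmod_ge_0 b).
    assert (Q3 := Cmod_ge_0 c). lra. }
  (* [K] bounds the quadratic Taylor polynomial on |d| = t < 1. With this eps the Taylor error costs
     at most 2 K eps t^2 = eta t^2 / 2, half of the gain eta t^2. *)
  assert (Heps : 0 < eta / (4 * K)) by (apply Rdiv_lt_0_compat; lra).
  set (eps := eta / (4 * K)) in *.
  destruct (cderiv_taylor2 psi h1 z0 (h2 z0) (1 - Cmod z0)) with (eps := eps)
    as [d1 [Hd1 HT]]; try assumption; [lra| |apply Hh; exact Hz0|].
  { intros w Hw. apply Hh. assert (H := Cmod_minus_ge w z0). lra. }
  fold a b c in HT. clearbody a b c.
  set (t := Rmin (Rmin delta d1) 1 / 2).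
  assert (Hm : 0 < Rmin (Rmin delta d1) 1) by (repeat apply Rmin_pos; lra).
  assert (Ht : 0 < t) by (unfold t; lra).
  assert (M1 := Rmin_l (Rmin delta d1) 1). assert (M2 := Rmin_r (Rmin delta d1) 1).
  assert (M3 := Rmin_l delta d1). assert (M4 := Rmin_r delta d1).
  assert (Ht1 : t < 1) by (unfold t; lra).
  assert (Htd : t < delta) by (unfold t; lra).
  assert (Htd1 : t < d1) by (unfold t; lra).
  assert (Key : forall d, Cmod d = t ->
    Cmod (a + b * d + c * (d * d))%C ^ 2 - 2 * K * (eps * t ^ 2) + eta * Cmod (z0 + d)%C ^ 2
     <= Cmod a ^ 2 + eta * Cmod z0 ^ 2).
  { intros d Hd. eapply Rle_trans; [|apply (Hmax d); lra].
    apply Rplus_le_compat_r.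
    specialize (HT d ltac:(lra)). rewrite Hd in HT.
    set (A := (a + b * d + c * (d * d))%C) in *.
    assert (HA : Cmod A <= K).
    { unfold A. eapply Rle_trans; [apply Cmod_triangle|].
      eapply Rle_trans; [apply Rplus_le_compat_r, Cmod_triangle|].
      rewrite !Cmod_mult, Hd. assert (Q2 := Cmod_ge_0 b). assert (Q3 := Cmod_ge_0 c).
      assert (t * t <= 1) by nra.
      assert (Cmod b * t <= Cmod b) by nra.
      assert (Cmod c * (t * t) <= Cmod c) by nra. unfold K. lra. }
    assert (HA2 : Cmod A - eps * t ^ 2 <= Cmod (psi (z0 + d)%C)).
    { rewrite Cmod_minus_sym in HT. assert (Q := Cmod_minus_ge A (psi (z0 + d)%C)). lra. }
    assert (Q1 := Cmod_ge_0 A). assert (Q2 := Cmod_ge_0 (psi (z0 + d)%C)).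
    assert (He2 : 0 <= eps * t ^ 2) by nra.
    set (x := Cmod (psi (z0 + d)%C)) in *. set (y := Cmod A) in *. set (e := eps * t ^ 2) in *.
    assert (y ^ 2 - 2 * y * e <= x ^ 2).
    (* If y <= e, the left side is at most -y^2; otherwise it is at most (y - e)^2, and 0 < y - e <=
       x. *)
    { destruct (Rle_lt_dec y e); nra. }
    nra. }
  assert (Ct : Cmod t = t) by (rewrite Cmod_R; apply Rabs_pos_eq; lra).
  assert (K1 := Key (RtoC t) Ct).
  assert (K2 := Key (Ci * t)%C ltac:(rewrite Cmod_mult, Cmod_Ci, Ct; ring)).
  assert (K3 := Key (- t)%C ltac:(rewrite Cmod_opp; exact Ct)).
  assert (K4 := Key (Ci * - t)%C ltac:(rewrite Cmod_mult, Cmod_opp, Cmod_Ci, Ct; ring)).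
  assert (I1 := four_point_identity a b c t).
  (* The same identity for the polynomial z0 + d: the mean of |z0 + d|^2 is |z0|^2 + t^2. *)
  assert (I2 := four_point_identity z0 (RtoC 1) (RtoC 0) t).
  replace (z0 + 1 * t + 0 * (t * t))%C with (z0 + t)%C in I2 by ring.
  replace (z0 + 1 * (Ci * t) + 0 * (Ci * t * (Ci * t)))%C with (z0 + Ci * t)%C in I2 by ring.
  replace (z0 + 1 * (- t) + 0 * (- t * - t))%C with (z0 + - t)%C in I2 by ring.
  replace (z0 + 1 * (Ci * - t) + 0 * (Ci * - t * (Ci * - t)))%C with (z0 + Ci * - t)%C in I2 by ring.
  rewrite Cmod_1, Cmod_0 in I2.
  assert (EE : 2 * K * (eps * t ^ 2) = eta / 2 * t ^ 2) by (unfold eps; field; lra).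
  rewrite EE in K1, K2, K3, K4.
  assert (Ht2 : 0 < eta * t ^ 2) by (apply Rmult_lt_0_compat; [|apply pow_lt]; lra).
  assert (P1 : 0 <= Cmod b ^ 2 * t ^ 2) by (rewrite <- Rpow_mult_distr; apply pow2_ge_0).
  assert (P2 : 0 <= Cmod c ^ 2 * t ^ 4).
  { apply Rmult_le_pos; [apply pow2_ge_0|]. apply pow_le. lra. }
  nra.
Qed.

(** Stands in for the limit r -> 1 in the Schwarz lemma: on circles near the boundary the bound 1 /
    r^n drops below any given M > 1. *)
Lemma pow_inv_lt_near_one (n : nat) (M : R) :
  1 < M -> exists s, 0 <= s < 1 /\ forall r, s < r < 1 -> 1 < M * r ^ n.
Proof.
  intros HM.
  assert (Hc : continuity_pt (fun r => M * r ^ n) 1) by reg.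
  assert (HM1 : 0 < M - 1) by lra.
  destruct (Hc (M - 1) HM1) as [d [Hd H]].
  exists (Rmax 0 (1 - d)). split.
  { split; [apply Rmax_l|]. apply Rmax_lub_lt; lra. }
  intros r [Hr1 Hr2]. assert (Q := Rmax_r 0 (1 - d)).
  assert (H' : Rabs (M * r ^ n - M * 1 ^ n) < M - 1).
  { apply (H r). split; [split; [exact I|lra]|].
    unfold dist; simpl; unfold R_dist. apply Rabs_def1; lra. }
  rewrite pow1 in H'. apply Rabs_def2 in H'. lra.
Qed.

(** This is the Schwarz lemma for z^n psi. If |psi(z1)| > 1, some circle |z| = rho around [z1] has
    |psi| <= 1 / rho^n < |psi(z1)|, and a small multiple of |z|^2 can be added to |psi|^2 without
    moving the maximum to the circle. *)
Lemma hol2_schwarz (psi : C -> C) (n : nat) :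
  hol2 psi -> (forall z, unit_disk z -> Cmod z ^ n * Cmod (psi z) <= 1) ->
  forall z, unit_disk z -> Cmod (psi z) <= 1.
Proof.
  intros Hpsi Hb z1 Hz1. unfold unit_disk in *.
  apply Rnot_lt_le. intros HM.
  destruct (pow_inv_lt_near_one n _ HM) as [s [Hs Hs2]].
  set (rho := (Rmax s (Cmod z1) + 1) / 2).
  assert (Q1 := Rmax_l s (Cmod z1)). assert (Q2 := Rmax_r s (Cmod z1)).
  assert (Q3 : Rmax s (Cmod z1) < 1) by (apply Rmax_lub_lt; lra).
  assert (Hr : s < rho < 1) by (unfold rho; lra).
  assert (Hr1 : Cmod z1 < rho) by (unfold rho; lra).
  specialize (Hs2 rho Hr).
  assert (Hp : 0 < rho ^ n) by (apply pow_lt; lra).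
  assert (Hi : / rho ^ n < Cmod (psi z1)).
  { apply (Rmult_lt_reg_r (rho ^ n)); [exact Hp|]. rewrite Rinv_l; lra. }
  assert (Hi0 : 0 < / rho ^ n) by (apply Rinv_0_lt_compat; exact Hp).
  (* Half of the gap: on the circle the perturbed function is below (1 / rho^n)^2 + eta, still less
     than |psi(z1)|^2. *)
  set (eta := (Cmod (psi z1) ^ 2 - (/ rho ^ n) ^ 2) / 2).
  assert (Heta : 0 < eta) by (unfold eta; nra).
  destruct Hpsi as [h1 [h2 Hh]].
  destruct (closed_disk_max (fun z => Cmod (psi z) ^ 2 + eta * Cmod z ^ 2) rho)
    as [z0 [Hz0 Hmax]]; [lra| |].
  { intros z Hz. apply continuous_at_plus.
    - apply (continuous_at_continuity (fun x => x ^ 2) (fun w => Cmod (psi w)));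
        [reg|]. apply cderiv_continuous_Cmod with (h1 z). apply Hh. unfold unit_disk. lra.
    - apply (continuous_at_continuity (fun x => eta * x ^ 2) Cmod); [reg|].
      apply (cderiv_continuous_Cmod (fun w => w) z 1). apply cderiv_id. }
  assert (Hz01 : Cmod z0 < rho).
  { destruct Hz0 as [Hz0|Hz0]; [exact Hz0|]. exfalso.
    specialize (Hmax z1 ltac:(lra)). cbv beta in Hmax. rewrite Hz0 in Hmax.
    specialize (Hb z0 ltac:(lra)). rewrite Hz0 in Hb.
    assert (Hb2 : Cmod (psi z0) <= / rho ^ n).
    { apply (Rmult_le_reg_l (rho ^ n)); [exact Hp|]. rewrite Rinv_r; lra. }
    assert (Q4 := Cmod_ge_0 (psi z0)). assert (Q5 := Cmod_ge_0 z1).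
    assert (rho ^ 2 < 1) by nra.
    assert (Cmod (psi z0) ^ 2 <= (/ rho ^ n) ^ 2) by nra.
    assert (eta * rho ^ 2 < eta) by nra. assert (0 <= eta * Cmod z1 ^ 2) by nra.
    unfold eta in *. lra. }
  apply (hol2_no_interior_max psi eta (rho - Cmod z0) z0); try lra.
  - exists h1, h2. exact Hh.
  - unfold unit_disk. lra.
  - intros d Hd. apply (Hmax (z0 + d)%C).
    eapply Rle_trans; [apply Cmod_triangle|]. lra.
Qed.

(** * Power series on the unit disk *)

Lemma is_series_Cmod_le (u : nat -> C) (l : C) (b : nat -> R) (s : R) :
  @is_series C_AbsRing C_NormedModule u l -> is_series b s ->
  (forall n, Cmod (u n) <= b n) -> Cmod l <= s.
Proof.
  intros Hu Hb Hle.
  apply (is_lim_seq_le (fun n => Cmod (@sum_n C_AbelianMonoid u n)) (fun n => sum_n b n) (Cmod l) s).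
  - intros n. eapply Rle_trans; [apply (@norm_sum_n_m C_AbsRing C_NormedModule)|].
    apply sum_n_m_le. exact Hle.
  - apply (filterlim_comp _ _ _ _ _ _ _ _ Hu).
    apply (@filterlim_norm C_AbsRing C_NormedModule).
  - exact Hb.
Qed.

Lemma is_series_nonneg (b : nat -> R) (s : R) :
  is_series b s -> (forall n, 0 <= b n) -> 0 <= s.
Proof.
  intros Hb Hn.
  apply (is_lim_seq_le (fun _ => 0) (fun n => sum_n b n) 0 s); [|apply is_lim_seq_const|exact Hb].
  intros n. induction n as [|n IH]; [rewrite sum_O; apply Hn|].
  rewrite sum_Sn. apply Rplus_le_le_0_compat; [exact IH|apply Hn].
Qed.

Lemma is_series_C_unique (u : nat -> C) (l k : C) :
  @is_series C_AbsRing C_NormedModule u l -> @is_series C_AbsRing C_NormedModule u k -> l = k.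
Proof.
  intros Hl Hk.
  exact (@filterlim_locally_unique _ C_AbsRing C_NormedModule _ _ _ _ _ Hl Hk).
Qed.

(* Radius of convergence at least 1. *)
Definition cauchy_bounded (a : nat -> C) : Prop :=
  forall r, 0 < r < 1 -> exists M, forall n, Cmod (a n) * r ^ n <= M.

(** Domination by M (r / s)^n, where s is the midpoint of r and 1. *)
Lemma cauchy_bounded_ex_series_Cmod (a : nat -> C) (r : R) :
  cauchy_bounded a -> 0 <= r < 1 -> ex_series (fun n => Cmod (a n) * r ^ n).
Proof.
  intros Ha Hr. set (s := (r + 1) / 2).
  assert (Hs : 0 < s < 1) by (unfold s; lra).
  destruct (Ha s Hs) as [M HM].
  apply (@ex_series_le R_AbsRing R_CompleteNormedModule _ (fun n => M * (r / s) ^ n)).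
  - intros n. unfold norm; simpl; unfold abs; simpl.
    rewrite Rabs_pos_eq by (apply Rmult_le_pos; [apply Cmod_ge_0|apply pow_le; lra]).
    assert (Hp : 0 < s ^ n) by (apply pow_lt; lra).
    replace (r ^ n) with (s ^ n * (r / s) ^ n).
    + rewrite <- Rmult_assoc. apply Rmult_le_compat_r; [|apply HM].
      apply pow_le. apply Rdiv_le_0_compat; lra.
    + rewrite <- Rpow_mult_distr. f_equal. field. lra.
  - apply (@ex_series_scal_l R_AbsRing R_NormedModule M (fun n => (r / s) ^ n)). apply ex_series_geom.
    rewrite Rabs_pos_eq by (apply Rdiv_le_0_compat; lra).
    apply Rlt_div_l; [lra|]. unfold s. lra.
Qed.

Lemma cauchy_bounded_mult_INR (a : nat -> C) : cauchy_bounded a -> cauchy_bounded (fun n => INR n * a n)%C.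
Proof.
  intros Ha r Hr. set (s := (r + 1) / 2).
  assert (Hs : r < s < 1) by (unfold s; lra).
  destruct (Ha s ltac:(lra)) as [M HM].
  set (d := s / r - 1).
  assert (Hd : 0 < d).
  { unfold d. assert (1 < s / r); [|lra]. apply Rlt_div_r; lra. }
  exists (M / d). intros n.
  rewrite Cmod_mult, Cmod_R, Rabs_pos_eq by apply pos_INR.
  (* [poly] is Bernoulli's inequality: the room between r and s absorbs the linear factor, since n d
     <= (s / r)^n. *)
  assert (HP := poly n d Hd).
  replace (1 + d) with (s / r) in HP by (unfold d; ring).
  assert (Hrn : 0 < r ^ n) by (apply pow_lt; lra).
  apply (Rle_div_r _ _ d Hd).
  apply Rle_trans with (Cmod (a n) * s ^ n); [|apply HM].
  replace (s ^ n) with ((s / r) ^ n * r ^ n).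
  - replace (INR n * Cmod (a n) * r ^ n * d) with (Cmod (a n) * (INR n * d * r ^ n)) by ring.
    apply Rmult_le_compat_l; [apply Cmod_ge_0|].
    apply Rmult_le_compat_r; lra.
  - rewrite <- Rpow_mult_distr. f_equal. field. lra.
Qed.

Lemma cauchy_bounded_shift (a : nat -> C) : cauchy_bounded a -> cauchy_bounded (fun n => a (S n)).
Proof.
  intros Ha r Hr. destruct (Ha r Hr) as [M HM]. exists (M / r). intros n.
  apply (Rle_div_r _ _ r (proj1 Hr)). specialize (HM (S n)). simpl in HM. lra.
Qed.

Lemma cauchy_bounded_plus_scal (a b : nat -> C) (c : C) :
  cauchy_bounded a -> cauchy_bounded b -> cauchy_bounded (fun n => a n + c * b n)%C.
Proof.
  intros Ha Hb r Hr. destruct (Ha r Hr) as [M HM]. destruct (Hb r Hr) as [K HK].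
  exists (M + Cmod c * K). intros n.
  assert (Hp : 0 <= r ^ n) by (apply pow_le; lra).
  apply Rle_trans with ((Cmod (a n) + Cmod c * Cmod (b n)) * r ^ n).
  - apply Rmult_le_compat_r; [exact Hp|]. rewrite <- Cmod_mult. apply Cmod_triangle.
  - specialize (HM n). specialize (HK n).
    apply (Rmult_le_compat_l (Cmod c)) in HK; [|apply Cmod_ge_0]. lra.
Qed.

Lemma is_pseries_C (a : nat -> C) (z l : C) :
  @is_pseries C_AbsRing C_NormedModule a z l <->
  @is_series C_AbsRing C_NormedModule (fun n => a n * z ^ n)%C l.
Proof.
  split; apply is_series_ext; intros n.
  - change ((z ^ n * a n)%C = (a n * z ^ n)%C). ring.
  - change ((a n * z ^ n)%C = (z ^ n * a n)%C). ring.
Qed.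

(** Partial sums of a convergent series are bounded by some M, and each later term is a difference
    of two of them, hence the bound M + M. *)
Lemma pseries_cauchy_bounded (a : nat -> C) :
  (forall z, unit_disk z -> exists l, @is_pseries C_AbsRing C_NormedModule a z l) -> cauchy_bounded a.
Proof.
  intros H r Hr. destruct (H (RtoC r)) as [l Hl].
  { unfold unit_disk. rewrite Cmod_R, Rabs_pos_eq; lra. }
  apply (proj1 (is_pseries_C _ _ _)) in Hl.
  destruct (@filterlim_bounded C_AbsRing C_NormedModule
    (@sum_n C_AbelianMonoid (fun n => (a n * r ^ n)%C))) as [M HM].
  { exists l. exact Hl. }
  change (forall n, Cmod (@sum_n C_AbelianMonoid (fun n => (a n * r ^ n)%C) n) <= M) in HM.
  assert (HM0 : 0 <= M) by (eapply Rle_trans; [apply Cmod_ge_0|apply (HM 0%nat)]).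
  exists (M + M). intros n.
  replace (Cmod (a n) * r ^ n) with (Cmod (a n * r ^ n)%C)
    by (rewrite Cmod_mult, Cmod_pow, Cmod_R, Rabs_pos_eq by lra; reflexivity).
  destruct n as [|n].
  - specialize (HM 0%nat). rewrite sum_O in HM. lra.
  - assert (H1 := HM n). assert (H2 := HM (S n)). rewrite sum_Sn in H2.
    change (Cmod (@sum_n C_AbelianMonoid (fun n => (a n * r ^ n)%C) n + a (S n) * r ^ S n)%C <= M) in H2.
    set (T := @sum_n C_AbelianMonoid (fun n => (a n * r ^ n)%C) n) in *.
    replace (a (S n) * r ^ S n)%C with ((T + a (S n) * r ^ S n) - T)%C by ring.
    eapply Rle_trans; [apply Cmod_minus_le|]. lra.
Qed.

(* Arbitrary where the series diverges. *)
Definition CPS (a : nat -> C) (z : C) : C :=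
  epsilon (inhabits (RtoC 0)) (fun l => @is_pseries C_AbsRing C_NormedModule a z l).

Lemma CPS_unique (a : nat -> C) (z l : C) :
  @is_pseries C_AbsRing C_NormedModule a z l -> CPS a z = l.
Proof.
  intros Hl.
  assert (He : @is_pseries C_AbsRing C_NormedModule a z (CPS a z)).
  { unfold CPS. apply epsilon_spec. exists l. exact Hl. }
  eapply is_series_C_unique; [exact He|exact Hl].
Qed.

Lemma CPS_correct (a : nat -> C) (z : C) :
  cauchy_bounded a -> unit_disk z -> @is_series C_AbsRing C_NormedModule (fun n => a n * z ^ n)%C (CPS a z).
Proof.
  intros Ha Hz.
  assert (Hex : exists l, @is_pseries C_AbsRing C_NormedModule a z l).
  { destruct (@ex_series_le C_AbsRing C_CompleteNormedModule (fun n => (a n * z ^ n)%C)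
      (fun n => Cmod (a n) * Cmod z ^ n)) as [l Hl].
    - intros n. change (Cmod (a n * z ^ n)%C <= Cmod (a n) * Cmod z ^ n).
      rewrite Cmod_mult, Cmod_pow. apply Rle_refl.
    - apply cauchy_bounded_ex_series_Cmod; [exact Ha|]. split; [apply Cmod_ge_0|exact Hz].
    - exists l. apply (proj2 (is_pseries_C _ _ _)). exact Hl. }
  apply (proj1 (is_pseries_C _ _ _)). unfold CPS. apply epsilon_spec. exact Hex.
Qed.

Lemma CPS_shift (a : nat -> C) (z : C) :
  cauchy_bounded a -> unit_disk z -> CPS a z = (a 0%nat + z * CPS (fun n => a (S n)) z)%C.
Proof.
  intros Ha Hz. apply CPS_unique. apply (proj2 (is_pseries_C _ _ _)).
  assert (H := CPS_correct _ z (cauchy_bounded_shift _ Ha) Hz).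
  apply (@is_series_scal_l C_AbsRing C_NormedModule z) in H.
  apply (@is_series_decr_1 C_AbsRing C_NormedModule).
  eapply is_series_ext in H.
  - replace (@plus C_NormedModule (a 0%nat + z * CPS (fun n => a (S n)) z)%C
      (@opp C_NormedModule (a 0%nat * z ^ 0)%C)) with (z * CPS (fun n => a (S n)) z)%C; [exact H|].
    change ((z * CPS (fun n => a (S n)) z)%C =
      (a 0%nat + z * CPS (fun n => a (S n)) z + - (a 0%nat * z ^ 0))%C). simpl. ring.
  - intros n. change ((z * (a (S n) * z ^ n))%C = (a (S n) * z ^ S n)%C).
    rewrite Cpow_S. ring.
Qed.

Lemma CPS_plus_scal (a b : nat -> C) (c z : C) :
  cauchy_bounded a -> cauchy_bounded b -> unit_disk z ->
  CPS (fun n => a n + c * b n)%C z = (CPS a z + c * CPS b z)%C.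
Proof.
  intros Ha Hb Hz. apply CPS_unique. apply (proj2 (is_pseries_C _ _ _)).
  assert (H1 := CPS_correct _ z Ha Hz). assert (H2 := CPS_correct _ z Hb Hz).
  apply (@is_series_scal_l C_AbsRing C_NormedModule c) in H2.
  assert (H3 := @is_series_plus C_AbsRing C_NormedModule _ _ _ _ H1 H2).
  eapply is_series_ext; [|exact H3].
  intros n. change ((a n * z ^ n + c * (b n * z ^ n))%C = ((a n + c * b n) * z ^ n)%C). ring.
Qed.

Lemma CPS_0 (a : nat -> C) : cauchy_bounded a -> CPS a (RtoC 0) = a 0%nat.
Proof.
  intros Ha. rewrite CPS_shift; [ring|exact Ha|]. unfold unit_disk. rewrite Cmod_0. lra.
Qed.

(** Both sides carry r^2 so that the exponent n - 2 never appears. The induction multiplies the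
    error by w and adds n z^(n - 1) (w - z)^2, and n^2 + n <= (n + 1)^2. For n = 0 the exponent
    [pred n] is harmless because its coefficient vanishes. *)
Lemma Cpow_taylor_bound (w z : C) (r : R) (n : nat) :
  0 < r -> Cmod w <= r -> Cmod z <= r ->
  Cmod (w ^ n - z ^ n - (w - z) * (INR n * z ^ pred n))%C * r ^ 2
    <= INR n ^ 2 * r ^ n * Cmod (w - z)%C ^ 2.
Proof.
  intros Hr Hw Hz. induction n as [|n IH].
  - simpl. replace (1 - 1 - (w - z) * (0 * 1))%C with (RtoC 0) by ring. rewrite Cmod_0. lra.
  - assert (E : (w ^ S n - z ^ S n - (w - z) * (INR (S n) * z ^ pred (S n)))%C
      = (w * (w ^ n - z ^ n - (w - z) * (INR n * z ^ pred n))
         + (w - z) * (w - z) * (INR n * z ^ pred n))%C).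
    { rewrite S_INR, RtoC_plus. destruct n as [|n]; simpl pred.
      - simpl. ring.
      - rewrite !Cpow_S. ring. }
    assert (B : INR n * Cmod z ^ pred n * r ^ 2 <= INR n * r ^ S n).
    { destruct n as [|n]; [simpl; lra|]. simpl pred.
      replace (r ^ S (S n)) with (r ^ n * r ^ 2) by (simpl; ring).
      rewrite Rmult_assoc. apply Rmult_le_compat_l; [apply pos_INR|].
      apply Rmult_le_compat_r; [apply pow2_ge_0|]. apply pow_incr. split; [apply Cmod_ge_0|exact Hz]. }
    rewrite E. set (X := (w ^ n - z ^ n - (w - z) * (INR n * z ^ pred n))%C) in *.
    assert (T : Cmod (w * X + (w - z) * (w - z) * (INR n * z ^ pred n))%C
      <= r * Cmod X + Cmod (w - z)%C ^ 2 * (INR n * Cmod z ^ pred n)).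
    { eapply Rle_trans; [apply Cmod_triangle|].
      rewrite !Cmod_mult, Cmod_R, Cmod_pow, (Rabs_pos_eq (INR n)) by apply pos_INR.
      apply Rplus_le_compat; [|lra].
      apply Rmult_le_compat_r; [apply Cmod_ge_0|exact Hw]. }
    apply Rle_trans with ((r * Cmod X + Cmod (w - z)%C ^ 2 * (INR n * Cmod z ^ pred n)) * r ^ 2).
    { apply Rmult_le_compat_r; [apply pow2_ge_0|exact T]. }
    set (q := Cmod (w - z)%C ^ 2) in *.
    assert (Hq : 0 <= q) by apply pow2_ge_0.
    assert (Hn := pos_INR n). rewrite S_INR.
    assert (Hrn : 0 < r ^ n) by (apply pow_lt; lra).
    apply (Rmult_le_compat_l r) in IH; [|lra].
    apply (Rmult_le_compat_l q) in B; [|exact Hq]. simpl (r ^ S n) in *.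
    assert (0 <= q * (r * r ^ n) * (INR n + 1)).
    { apply Rmult_le_pos; [apply Rmult_le_pos; [exact Hq|apply Rmult_le_pos; lra]|lra]. }
    lra.
Qed.

Definition CPS_deriv (a : nat -> C) (n : nat) : C := (INR (S n) * a (S n))%C.

Lemma cauchy_bounded_deriv (a : nat -> C) : cauchy_bounded a -> cauchy_bounded (CPS_deriv a).
Proof. intros Ha. apply (cauchy_bounded_shift (fun n => (INR n * a n)%C)), cauchy_bounded_mult_INR, Ha. Qed.

(** Termwise differentiation: the quadratic errors of the powers add up to at most s |w - z|^2 /
    r^2, where s is the sum of n^2 |a_n| r^n, finite because [cauchy_bounded] survives two
    multiplications by n. *)
Lemma cderiv_CPS (a : nat -> C) (z : C) :
  cauchy_bounded a -> unit_disk z -> cderiv (CPS a) z (CPS (CPS_deriv a) z).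
Proof.
  intros Ha Hz eps He. unfold unit_disk in Hz.
  assert (Hz0 := Cmod_ge_0 z).
  set (r := (Cmod z + 1) / 2).
  assert (Hr : Cmod z < r < 1) by (unfold r; lra).
  assert (HS : ex_series (fun n => INR n ^ 2 * (Cmod (a n) * r ^ n))).
  { apply (@ex_series_ext R_AbsRing R_NormedModule
      (fun n => Cmod (INR n * (INR n * a n))%C * r ^ n)).
    - intros n. change (Cmod (INR n * (INR n * a n))%C * r ^ n
        = INR n ^ 2 * (Cmod (a n) * r ^ n)).
      rewrite !Cmod_mult, Cmod_R, Rabs_pos_eq by apply pos_INR. ring.
    - apply (cauchy_bounded_ex_series_Cmod _ r (cauchy_bounded_mult_INR _ (cauchy_bounded_mult_INR _ Ha))). lra. }
  destruct HS as [s Hs].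
  assert (Hs0 : 0 <= s).
  { apply (is_series_nonneg _ _ Hs). intros n. apply Rmult_le_pos; [apply pow2_ge_0|].
    apply Rmult_le_pos; [apply Cmod_ge_0|apply pow_le; lra]. }
  exists (Rmin (r - Cmod z) (eps * r ^ 2 / (s + 1))). split.
  { apply Rmin_pos; [lra|]. apply Rdiv_lt_0_compat; [|lra].
    apply Rmult_lt_0_compat; [lra|]. apply pow_lt; lra. }
  intros w Hw.
  assert (W1 := Rlt_le_trans _ _ _ Hw (Rmin_l _ _)).
  assert (W2 := Rlt_le_trans _ _ _ Hw (Rmin_r _ _)).
  assert (Hwr : Cmod w <= r) by (assert (H := Cmod_minus_ge w z); lra).
  assert (S1 := CPS_correct a w Ha ltac:(unfold unit_disk; lra)).
  assert (S2 := CPS_correct a z Ha ltac:(unfold unit_disk; lra)).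
  (* The derived series is re-indexed with a zero term in front, so that it aligns with the other
     two term by term. *)
  assert (S3 : @is_series C_AbsRing C_NormedModule (fun n => (INR n * a n * z ^ pred n)%C)
    (CPS (CPS_deriv a) z)).
  { assert (H := CPS_correct _ z (cauchy_bounded_deriv _ Ha) Hz).
    apply (@is_series_decr_1 C_AbsRing C_NormedModule).
    replace (@plus C_NormedModule _ _) with (CPS (CPS_deriv a) z).
    - exact H.
    - change (CPS (CPS_deriv a) z = (CPS (CPS_deriv a) z + - (INR 0 * a 0%nat * z ^ pred 0))%C).
      simpl. ring. }
  assert (S4 := @is_series_minus C_AbsRing C_NormedModule _ _ _ _ S1 S2).
  apply (@is_series_scal_l C_AbsRing C_NormedModule (w - z)%C) in S3.
  assert (S5 := @is_series_minus C_AbsRing C_NormedModule _ _ _ _ S4 S3).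
  assert (Hbound : Cmod (CPS a w - CPS a z - (w - z) * CPS (CPS_deriv a) z)%C
    <= Cmod (w - z)%C ^ 2 / r ^ 2 * s).
  { eapply is_series_Cmod_le; [exact S5|apply (@is_series_scal_l R_AbsRing R_NormedModule _ _ _ Hs)|].
    intros n.
    change (Cmod (a n * w ^ n + - (a n * z ^ n) + - ((w - z) * (INR n * a n * z ^ pred n)))%C
      <= Cmod (w - z)%C ^ 2 / r ^ 2 * (INR n ^ 2 * (Cmod (a n) * r ^ n))).
    replace (a n * w ^ n + - (a n * z ^ n) + - ((w - z) * (INR n * a n * z ^ pred n)))%C
      with (a n * (w ^ n - z ^ n - (w - z) * (INR n * z ^ pred n)))%C by ring.
    rewrite Cmod_mult.
    assert (B := Cpow_taylor_bound w z r n ltac:(lra) Hwr ltac:(lra)).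
    assert (Hr2 : 0 < r ^ 2) by (apply pow_lt; lra).
    apply (Rmult_le_reg_r (r ^ 2)); [exact Hr2|].
    apply (Rmult_le_compat_l (Cmod (a n))) in B; [|apply Cmod_ge_0].
    replace (Cmod (w - z)%C ^ 2 / r ^ 2 * (INR n ^ 2 * (Cmod (a n) * r ^ n)) * r ^ 2)
      with (Cmod (a n) * (INR n ^ 2 * r ^ n * Cmod (w - z)%C ^ 2)) by (field; lra).
    lra. }
  eapply Rle_trans; [exact Hbound|].
  assert (Hx := Cmod_ge_0 (w - z)%C). set (x := Cmod (w - z)%C) in *.
  assert (Hr2 : 0 < r ^ 2) by (apply pow_lt; lra).
  apply (Rmult_le_reg_r (r ^ 2)); [exact Hr2|].
  replace (x ^ 2 / r ^ 2 * s * r ^ 2) with (x * (x * s)) by (field; lra).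
  apply (Rmult_lt_compat_r (s + 1)) in W2; [|lra].
  replace (eps * r ^ 2 / (s + 1) * (s + 1)) with (eps * r ^ 2) in W2 by (field; lra).
  replace (eps * x * r ^ 2) with (x * (eps * r ^ 2)) by ring.
  apply Rmult_le_compat_l; [exact Hx|]. lra.
Qed.

Lemma hol2_CPS (a : nat -> C) : cauchy_bounded a -> hol2 (CPS a).
Proof.
  intros Ha. exists (CPS (CPS_deriv a)), (CPS (CPS_deriv (CPS_deriv a))).
  intros z Hz. split; apply cderiv_CPS; try assumption. apply cauchy_bounded_deriv, Ha.
Qed.

(** * Caratheodory's coefficient bound *)

Fixpoint csum (u : nat -> C) (n : nat) : C :=
  match n with
  | O => RtoC 0
  | S k => (csum u k + u k)%C
  end.

Lemma csum_S (u : nat -> C) (n : nat) : csum u (S n) = (csum u n + u n)%C.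
Proof. reflexivity. Qed.

Lemma csum_ext (u v : nat -> C) (n : nat) :
  (forall k, (k < n)%nat -> u k = v k) -> csum u n = csum v n.
Proof.
  induction n as [|n IH]; intros H; [reflexivity|]. simpl.
  rewrite IH by (intros k Hk; apply H; lia). rewrite H by lia. reflexivity.
Qed.

Lemma csum_plus (u v : nat -> C) (n : nat) :
  csum (fun k => u k + v k)%C n = (csum u n + csum v n)%C.
Proof. induction n as [|n IH]; simpl; [ring|]. rewrite IH. ring. Qed.

Lemma csum_scal (c : C) (u : nat -> C) (n : nat) :
  csum (fun k => c * u k)%C n = (c * csum u n)%C.
Proof. induction n as [|n IH]; simpl; [ring|]. rewrite IH. ring. Qed.

Lemma csum_const (c : C) (n : nat) : csum (fun _ => c) n = (INR n * c)%C.
Proof.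
  induction n as [|n IH]; [simpl; ring|]. rewrite S_INR, RtoC_plus. simpl csum. rewrite IH. ring.
Qed.

Lemma csum_first (u : nat -> C) (n : nat) :
  csum u (S n) = (u 0%nat + csum (fun k => u (S k)) n)%C.
Proof.
  induction n as [|n IH]; [simpl; ring|].
  change (csum u (S (S n))) with (csum u (S n) + u (S n))%C. rewrite IH. simpl. ring.
Qed.

Lemma csum_exchange (u : nat -> nat -> C) (n m : nat) :
  csum (fun j => csum (fun k => u j k) n) m = csum (fun k => csum (fun j => u j k) m) n.
Proof.
  induction m as [|m IH]; simpl.
  - rewrite csum_const. ring.
  - rewrite IH, <- csum_plus. reflexivity.
Qed.

Lemma csum_geometric (w : C) (n : nat) :
  ((w - 1) * csum (fun k => w ^ k) n)%C = (w ^ n - 1)%C.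
Proof.
  induction n as [|n IH]; [simpl; ring|].
  simpl csum. rewrite Cmult_plus_distr_l, IH, Cpow_S. ring.
Qed.

Lemma hol2_csum (h : nat -> C -> C) (n : nat) :
  (forall k, hol2 (h k)) -> hol2 (fun z => csum (fun k => h k z) n).
Proof.
  intros H. induction n as [|n IH]; simpl; [apply hol2_const|].
  apply hol2_plus; [exact IH|apply H].
Qed.

Definition root_of_unity (n : nat) : C := (cos (2 * PI / INR n), sin (2 * PI / INR n)).

Lemma polar_pow (x : R) (k : nat) : ((cos x, sin x) ^ k)%C = (cos (INR k * x), sin (INR k * x)).
Proof.
  induction k as [|k IH].
  - simpl. rewrite Rmult_0_l, cos_0, sin_0. reflexivity.
  - rewrite Cpow_S, IH, S_INR, Rmult_plus_distr_r, Rmult_1_l, cos_plus, sin_plus.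
    unfold Cmult. simpl. f_equal; ring.
Qed.

Lemma Cmod_root_of_unity (n : nat) : Cmod (root_of_unity n) = 1.
Proof.
  assert (H := Cmod2_alt (root_of_unity n)). simpl in H.
  assert (Q := Cmod_ge_0 (root_of_unity n)).
  assert (H2 := sin2_cos2 (2 * PI / INR n)). unfold Rsqr in H2. nra.
Qed.

Lemma root_of_unity_pow (n : nat) : (1 <= n)%nat -> (root_of_unity n ^ n)%C = RtoC 1.
Proof.
  intros Hn. unfold root_of_unity. rewrite polar_pow.
  assert (0 < INR n) by (apply lt_0_INR; lia).
  replace (INR n * (2 * PI / INR n)) with (2 * PI) by (field; lra).
  rewrite cos_2PI, sin_2PI. reflexivity.
Qed.

(** With x = pi k / n in (0, pi), the real part of the power is 1 - 2 sin(x)^2, which is less than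
    1. *)
Lemma root_of_unity_primitive (n k : nat) :
  (0 < k < n)%nat -> (root_of_unity n ^ k)%C <> RtoC 1.
Proof.
  intros Hk H. unfold root_of_unity in H. rewrite polar_pow in H.
  injection H as H _.
  assert (Hn : 0 < INR n) by (apply lt_0_INR; lia).
  assert (Hk0 : 0 < INR k) by (apply lt_0_INR; lia).
  assert (Hkn : INR k < INR n) by (apply lt_INR; lia).
  set (x := INR k * PI / INR n).
  assert (Ex : INR k * (2 * PI / INR n) = 2 * x) by (unfold x; field; lra).
  rewrite Ex, cos_2a_sin in H.
  assert (HPI := PI_RGT_0).
  assert (Hx : 0 < x < PI).
  { unfold x. split; [apply Rdiv_lt_0_compat; [apply Rmult_lt_0_compat|]; lra|].
    apply Rlt_div_l; [lra|]. nra. }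
  assert (0 < sin x) by (apply sin_gt_0; lra). nra.
Qed.

(** A geometric sum with ratio w^k, where w^k differs from 1 but its n-th power is 1. *)
Lemma csum_root_of_unity (n k : nat) :
  (0 < k < n)%nat -> csum (fun j => (root_of_unity n ^ j) ^ k)%C n = RtoC 0.
Proof.
  intros Hk. set (w := root_of_unity n).
  rewrite (csum_ext _ (fun j => (w ^ k) ^ j)%C).
  2: { intros j _. rewrite <- !Cpow_mult_r. f_equal. lia. }
  assert (H := csum_geometric (w ^ k)%C n).
  replace ((w ^ k) ^ n)%C with (RtoC 1) in H.
  2: { rewrite <- Cpow_mult_r, Nat.mul_comm, Cpow_mult_r. unfold w.
       rewrite root_of_unity_pow by lia. symmetry. apply Cpow_1_l. }
  replace (1 - 1)%C with (RtoC 0) in H by ring.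
  destruct (Ceq_dec (csum (fun j => (w ^ k) ^ j)%C n) 0) as [E|E]; [exact E|].
  exfalso. apply (Cmult_neq_0 (w ^ k - 1) (csum (fun j => (w ^ k) ^ j) n)%C); [|exact E|exact H].
  apply Cminus_eq_contra, root_of_unity_primitive, Hk.
Qed.

(** The squares of the two sides differ by 4 Re p. *)
Lemma Cayley_bound (p : C) : 0 < Re p -> Cmod (p - 1)%C <= Cmod (p + 1)%C.
Proof.
  intros Hp. assert (H1 := Cmod2_alt (p - 1)%C). assert (H2 := Cmod2_alt (p + 1)%C).
  destruct p as [x y]. simpl in *.
  assert (Q1 := Cmod_ge_0 ((x, y) - 1)%C). assert (Q2 := Cmod_ge_0 ((x, y) + 1)%C). nra.
Qed.

Lemma Re_pos_neq_0 (p : C) : 0 < Re p -> p <> RtoC 0.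
Proof. intros Hp E. rewrite E in Hp. simpl in Hp. lra. Qed.

Lemma csum_Re_pos (u : nat -> C) (n : nat) :
  (1 <= n)%nat -> (forall k, (k < n)%nat -> 0 < Re (u k)) -> 0 < Re (csum u n).
Proof.
  intros Hn. induction Hn as [|n Hn IH]; intros H; simpl csum; rewrite re_plus.
  - simpl. rewrite Rplus_0_l. apply H. lia.
  - apply Rplus_lt_0_compat; [apply IH; intros k Hk|]; apply H; lia.
Qed.

(* Averaging [p] over the rotations by n-th roots of unity removes the coefficients of order
   1, ..., n - 1, so that the Cayley transform of the average vanishes to order [n] at 0. *)
Lemma caratheodory (p q : C -> C) (u : nat -> C) (n : nat) :
  (1 <= n)%nat -> u 0%nat = RtoC 1 -> hol2 p -> hol2 q ->
  (forall z, unit_disk z -> 0 < Re (p z)) ->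
  (forall z, unit_disk z -> p z = csum (fun k => u k * z ^ k)%C n + z ^ n * q z)%C ->
  Cmod (q (RtoC 0)) <= 2.
Proof.
  intros Hn Hu0 Hp Hq Hpos Hexp.
  set (w := root_of_unity n).
  assert (Hw : forall j, Cmod (w ^ j)%C = 1).
  { intros j. rewrite Cmod_pow. unfold w. rewrite Cmod_root_of_unity. apply pow1. }
  assert (Hn0 : 0 < INR n) by (apply lt_0_INR; lia).
  assert (HnC : RtoC (INR n) <> RtoC 0) by (intros E; apply RtoC_inj in E; lra).
  set (P := fun z => (/ INR n * csum (fun j => p (w ^ j * z)) n)%C).
  set (Q := fun z => (/ INR n * csum (fun j => q (w ^ j * z)) n)%C).
  assert (HP : hol2 P).
  { apply (hol2_mult (fun _ => (/ INR n)%C)); [apply hol2_const|].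
    apply (hol2_csum (fun j z => p (w ^ j * z)%C)). intros j. apply hol2_rotate; [apply Hw|exact Hp]. }
  assert (HQ : hol2 Q).
  { apply (hol2_mult (fun _ => (/ INR n)%C)); [apply hol2_const|].
    apply (hol2_csum (fun j z => q (w ^ j * z)%C)). intros j. apply hol2_rotate; [apply Hw|exact Hq]. }
  assert (HPpos : forall z, unit_disk z -> 0 < Re (P z)).
  { intros z Hz. unfold P. rewrite <- RtoC_inv by lra. rewrite re_scal_l.
    apply Rmult_lt_0_compat; [apply Rinv_0_lt_compat; exact Hn0|].
    apply csum_Re_pos; [exact Hn|]. intros j _. apply Hpos.
    unfold unit_disk in *. rewrite Cmod_mult, Hw. lra. }
  assert (HPQ : forall z, unit_disk z -> P z = (1 + z ^ n * Q z)%C).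
  { intros z Hz. unfold P, Q.
    rewrite (csum_ext _ (fun j => csum (fun k => (u k * z ^ k) * (w ^ j) ^ k) n
      + z ^ n * q (w ^ j * z))%C).
    2: { intros j _. rewrite Hexp.
         - f_equal.
           + apply csum_ext. intros k _. rewrite Cpow_mult_l. ring.
           + rewrite Cpow_mult_l, <- (Cpow_mult_r w j n), Nat.mul_comm, Cpow_mult_r.
             unfold w at 1. rewrite root_of_unity_pow, Cpow_1_l by exact Hn. ring.
         - unfold unit_disk in *. rewrite Cmod_mult, Hw. lra. }
    rewrite csum_plus, csum_exchange, csum_scal.
    (* After the exchange the inner sum vanishes for 0 < k < n, and k = 0 contributes n times [u 0],
       that is n. *)
    assert (E : csum (fun k => csum (fun j => (u k * z ^ k) * (w ^ j) ^ k)%C n) n = INR n).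
    { destruct n as [|m]; [lia|]. rewrite csum_first.
      rewrite (csum_ext (fun k => csum _ _) (fun _ => RtoC 0)).
      - rewrite csum_const, Hu0. rewrite (csum_ext _ (fun _ => RtoC 1)).
        + rewrite csum_const. ring.
        + intros j _. simpl. ring.
      - intros k Hk. rewrite csum_scal. unfold w. rewrite csum_root_of_unity by lia. ring. }
    rewrite E. field. exact HnC. }
  assert (HP1 : forall z, unit_disk z -> (P z + 1)%C <> RtoC 0).
  { intros z Hz. apply Re_pos_neq_0. rewrite re_plus, re_RtoC. specialize (HPpos z Hz). lra. }
  assert (H0 : unit_disk (RtoC 0)) by (unfold unit_disk; rewrite Cmod_0; lra).
  (* This is (P - 1) / (P + 1) divided by z^n. Since P(0) = 1, its value at 0 is q(0) / 2, which is
     where the bound 2 comes from. *)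
  set (psi := fun z => (Q z * / (P z + 1))%C).
  assert (Hpsi : Cmod (psi (RtoC 0)) <= 1).
  { apply hol2_schwarz with (n := n); [| |exact H0].
    - unfold psi. apply hol2_mult; [exact HQ|].
      apply (hol2_inv (fun z => P z + 1)%C); [|exact HP1].
      apply hol2_plus; [exact HP|apply hol2_const].
    - intros z Hz. rewrite <- Cmod_pow, <- Cmod_mult. unfold psi.
      replace (z ^ n * (Q z * / (P z + 1)))%C with ((P z - 1) / (P z + 1))%C.
      + rewrite Cmod_div by (apply HP1; exact Hz). apply Rle_div_l.
        * apply Cmod_gt_0, HP1, Hz.
        * rewrite Rmult_1_l. apply Cayley_bound, HPpos, Hz.
      + rewrite (HPQ z Hz) at 1. field. apply HP1, Hz. }
  assert (EP : P (RtoC 0) = RtoC 1).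
  { rewrite HPQ by exact H0. destruct n as [|m]; [lia|]. rewrite Cpow_S. ring. }
  assert (EQ : Q (RtoC 0) = q (RtoC 0)).
  { unfold Q. rewrite (csum_ext _ (fun _ => q (RtoC 0))).
    - rewrite csum_const. field. exact HnC.
    - intros j _. f_equal. ring. }
  unfold psi in Hpsi. rewrite EP, EQ in Hpsi.
  replace (1 + 1)%C with (RtoC 2) in Hpsi by ring.
  rewrite Cmod_mult, <- RtoC_inv, Cmod_R, Rabs_pos_eq in Hpsi by lra. lra.
Qed.

(* [quot_rem b g n] are the coefficients of [(G - F * T) / z^n], where [F] and [G] are the
   power series with coefficients [b] and [g], and [T] is the Taylor polynomial of degree
   [n - 1] of [G / F], for [b 0 = 1]. *)
Fixpoint quot_rem (b g : nat -> C) (n : nat) : nat -> C :=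
  match n with
  | O => g
  | S k => fun i => (quot_rem b g k (S i) + - quot_rem b g k 0%nat * b (S i))%C
  end.

Lemma cauchy_bounded_quot_rem (b g : nat -> C) (n : nat) : cauchy_bounded b -> cauchy_bounded g -> cauchy_bounded (quot_rem b g n).
Proof.
  intros Hb Hg. induction n as [|n IH]; simpl; [exact Hg|].
  apply (cauchy_bounded_plus_scal (fun i => quot_rem b g n (S i)) (fun i => b (S i)));
    [apply (cauchy_bounded_shift _ IH)|apply (cauchy_bounded_shift _ Hb)].
Qed.

(** One step of long division: since [b 0] is 1, subtracting R_n(0) F from the remainder R_n cancels
    its constant term, and division by z gives R_(n+1). *)
Lemma quot_rem_expansion (b g : nat -> C) (n : nat) (z : C) :
  cauchy_bounded b -> cauchy_bounded g -> b 0%nat = RtoC 1 -> unit_disk z ->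
  CPS g z = (CPS b z * csum (fun k => quot_rem b g k 0%nat * z ^ k) n
             + z ^ n * CPS (quot_rem b g n) z)%C.
Proof.
  intros Hb Hg Hb0 Hz. induction n as [|n IH]; [simpl; ring|].
  rewrite IH. simpl csum. simpl (quot_rem b g (S n)).
  assert (HN := cauchy_bounded_quot_rem b g n Hb Hg).
  rewrite (CPS_plus_scal (fun i => quot_rem b g n (S i)) (fun i => b (S i)));
    [|apply (cauchy_bounded_shift _ HN)|apply (cauchy_bounded_shift _ Hb)|exact Hz].
  rewrite (CPS_shift (quot_rem b g n) z HN Hz), (CPS_shift b z Hb Hz), Hb0, Cpow_S. ring.
Qed.

(** The division unrolled; at [i = 0] it is the recursion for the Taylor coefficients of G / F. *)
Lemma quot_rem_eq (b g : nat -> C) (n i : nat) :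
  quot_rem b g n i
  = (g (n + i)%nat - csum (fun j => quot_rem b g j 0%nat * b (n + i - j)%nat) n)%C.
Proof.
  revert i. induction n as [|n IH]; intros i; [simpl; ring|].
  rewrite csum_S.
  change (quot_rem b g (S n) i)
    with (quot_rem b g n (S i) + - quot_rem b g n 0%nat * b (S i))%C.
  rewrite (IH (S i)).
  replace (n + S i)%nat with (S n + i)%nat by lia.
  replace (S n + i - n)%nat with (S i) by lia. ring.
Qed.

(** * Coefficient and distortion bounds for convex functions *)

(** The class expressed through the coefficients alone, which gives access to derivatives of every
    order. *)
Definition convex_coeffs (a : nat -> C) : Prop :=
  a 0%nat = RtoC 0 /\ a 1%nat = RtoC 1 /\ cauchy_bounded a /\
  forall z, unit_disk z ->
    CPS (CPS_deriv a) z <> RtoC 0 /\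
    0 < Re (1 + z * CPS (CPS_deriv (CPS_deriv a)) z / CPS (CPS_deriv a) z)%C.

(** [f1] and [f2] agree with the termwise derivatives by uniqueness of derivatives; the comparison
    is local, on a ball inside the disk, since nothing is known about [f] outside. *)
Lemma convex_class_coeffs (f : C -> C) (a : nat -> C) :
  convex_class f a -> convex_coeffs a /\ forall z, unit_disk z -> f z = CPS a z.
Proof.
  intros [H0 [H1 [Hf [f1 [f2 Hd]]]]].
  assert (Ha : cauchy_bounded a) by (apply pseries_cauchy_bounded; intros z Hz; exists (f z); apply Hf, Hz).
  assert (Ef : forall z, unit_disk z -> f z = CPS a z).
  { intros z Hz. symmetry. apply CPS_unique, Hf, Hz. }
  assert (Hball : forall z, unit_disk z -> forall w, Cmod (w - z)%C < 1 - Cmod z -> unit_disk w).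
  { intros z Hz w Hw. unfold unit_disk. assert (H := Cmod_minus_ge w z). lra. }
  assert (Ef1 : forall z, unit_disk z -> f1 z = CPS (CPS_deriv a) z).
  { intros z Hz. destruct (Hd z Hz) as [D1 _]. apply is_derive_cderiv in D1.
    apply (cderiv_unique f z); [exact D1|].
    apply (cderiv_ext_loc (CPS a) f z _ (1 - Cmod z)).
    - unfold unit_disk in Hz. lra.
    - intros w Hw. symmetry. apply Ef, (Hball z Hz w Hw).
    - apply cderiv_CPS; assumption. }
  assert (Ef2 : forall z, unit_disk z -> f2 z = CPS (CPS_deriv (CPS_deriv a)) z).
  { intros z Hz. destruct (Hd z Hz) as [_ [D2 _]]. apply is_derive_cderiv in D2.
    apply (cderiv_unique f1 z); [exact D2|].
    apply (cderiv_ext_loc (CPS (CPS_deriv a)) f1 z _ (1 - Cmod z)).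
    - unfold unit_disk in Hz. lra.
    - intros w Hw. symmetry. apply Ef1, (Hball z Hz w Hw).
    - apply cderiv_CPS; [apply cauchy_bounded_deriv|]; assumption. }
  split; [|exact Ef]. repeat split; try assumption.
  - rewrite <- Ef1 by assumption. apply Hd. assumption.
  - rewrite <- Ef1, <- Ef2 by assumption. apply Hd. assumption.
Qed.

Lemma CPS_deriv_0 (a : nat -> C) : a 1%nat = RtoC 1 -> CPS_deriv a 0 = RtoC 1.
Proof. intros H. unfold CPS_deriv. rewrite H. simpl. ring. Qed.

(** The right-hand side is twice the sum of m - j + 1 over j < k. *)
Lemma convolution_bound (u b : nat -> C) (m k : nat) :
  (forall j, Cmod (u (S j)) <= 2) -> (forall j, (j <= m)%nat -> Cmod (b j) <= INR j + 1) ->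
  (k <= m)%nat ->
  Cmod (csum (fun j => u (S j) * b (m - j)%nat)%C k)
    <= 2 * INR k * (INR m + 1) - INR k * (INR k - 1).
Proof.
  intros Hu Hb. induction k as [|k IH]; intros Hk.
  - simpl. rewrite Cmod_0. lra.
  - rewrite csum_S, S_INR. eapply Rle_trans; [apply Cmod_triangle|].
    specialize (IH ltac:(lia)). rewrite Cmod_mult.
    assert (B := Hb (m - k)%nat ltac:(lia)). rewrite minus_INR in B by lia.
    assert (Q := Cmod_ge_0 (b (m - k)%nat)).
    assert (Cmod (u (S k)) * Cmod (b (m - k)%nat) <= 2 * (INR m - INR k + 1)).
    { apply Rmult_le_compat; try apply Cmod_ge_0; [apply Hu|exact B]. }
    lra.
Qed.

(* With [p = 1 + z f'' / f' = sum p_n z^n], comparing coefficients in [(z f')' = p f'] gives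
   [n b_n = sum_(1 <= j <= n) p_j b_(n - j)] for [b_n = (n + 1) a_(n + 1)], and [|p_j| <= 2]. *)
Lemma convex_deriv_coeff_bound (a : nat -> C) (n : nat) :
  convex_coeffs a -> Cmod (CPS_deriv a n) <= INR n + 1.
Proof.
  intros [_ [Ha1 [Ha Hconv]]].
  set (b := CPS_deriv a) in *.
  assert (Hb : cauchy_bounded b) by (apply cauchy_bounded_deriv, Ha).
  assert (Hb0 : b 0%nat = RtoC 1) by (apply CPS_deriv_0, Ha1).
  (* Coefficients of (z f')' = f' + z f'', so that p is the quotient of the series of [g] and
     [b]. *)
  set (g := fun n => (INR n * b n + 1 * b n)%C).
  assert (Hg : cauchy_bounded g) by (apply cauchy_bounded_plus_scal; [apply cauchy_bounded_mult_INR|]; exact Hb).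
  assert (Eg : forall z, unit_disk z -> CPS g z = (CPS b z + z * CPS (CPS_deriv b) z)%C).
  { intros z Hz. unfold g. rewrite CPS_plus_scal; try assumption; [|apply cauchy_bounded_mult_INR, Hb].
    rewrite (CPS_shift (fun n => (INR n * b n)%C)); [|apply cauchy_bounded_mult_INR, Hb|exact Hz].
    change (fun n => (INR (S n) * b (S n))%C) with (CPS_deriv b). simpl INR. ring. }
  set (u := fun k => quot_rem b g k 0%nat).
  assert (Hu0 : u 0%nat = RtoC 1).
  { unfold u. simpl. unfold g. rewrite Hb0. simpl INR. ring. }
  assert (Hinv : hol2 (fun z => / CPS b z)%C).
  { apply hol2_inv; [apply hol2_CPS, Hb|]. intros z Hz. apply Hconv, Hz. }
  assert (Hu : forall j, Cmod (u (S j)) <= 2).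
  { intros j.
    set (q := fun z => (CPS (quot_rem b g (S j)) z * / CPS b z)%C).
    replace (u (S j)) with (q (RtoC 0)).
    2: { unfold q. rewrite !CPS_0 by (assumption || apply cauchy_bounded_quot_rem; assumption).
         rewrite Hb0. unfold u. field. }
    apply (caratheodory (fun z => CPS g z * / CPS b z)%C q u (S j)).
    - lia.
    - exact Hu0.
    - apply hol2_mult; [apply hol2_CPS, Hg|exact Hinv].
    - apply hol2_mult; [apply hol2_CPS, cauchy_bounded_quot_rem; assumption|exact Hinv].
    - intros z Hz. destruct (Hconv z Hz) as [Hn Hre]. rewrite Eg by exact Hz.
      replace ((CPS b z + z * CPS (CPS_deriv b) z) * / CPS b z)%C
        with (1 + z * CPS (CPS_deriv b) z / CPS b z)%C by (field; exact Hn).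
      exact Hre.
    - intros z Hz. destruct (Hconv z Hz) as [Hn _].
      rewrite (quot_rem_expansion b g (S j) z) by assumption.
      unfold q, u. field. exact Hn. }
  induction n as [n IH] using (well_founded_induction Nat.lt_wf_0).
  destruct n as [|m]; [rewrite Hb0, Cmod_1; simpl; lra|].
  (* In the recursion for the quotient, the term of index 0 is [b (S m)] and cancels the extra
     summand in [g (S m)]. *)
  assert (E : (INR (S m) * b (S m))%C
    = (u (S m) + csum (fun j => u (S j) * b (m - j)%nat) m)%C).
  { assert (E := quot_rem_eq b g (S m) 0). fold (u (S m)) in E.
    rewrite Nat.add_0_r in E. rewrite csum_first in E.
    change (quot_rem b g 0 0) with (u 0%nat) in E. rewrite Hu0 in E.
    change (fun k => (quot_rem b g (S k) 0%nat * b (S m - S k)%nat)%C)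
      with (fun j => (u (S j) * b (m - j)%nat)%C) in E.
    rewrite E. unfold g. rewrite Nat.sub_0_r. ring. }
  assert (B := convolution_bound u b m m Hu).
  specialize (B ltac:(intros j Hj; apply IH; lia) (le_n m)).
  (* The right-hand side equals (m + 1)(m + 2), so division by m + 1 reproduces the claimed bound
     exactly. *)
  assert (B2 : Cmod (INR (S m) * b (S m))%C
    <= 2 + (2 * INR m * (INR m + 1) - INR m * (INR m - 1))).
  { rewrite E. eapply Rle_trans; [apply Cmod_triangle|].
    apply Rplus_le_compat; [apply Hu|exact B]. }
  rewrite Cmod_mult, Cmod_R, Rabs_pos_eq in B2 by apply pos_INR.
  assert (Hm := pos_INR m). rewrite S_INR in *.
  apply (Rmult_le_reg_l (INR m + 1)); [lra|]. lra.
Qed.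

Lemma convex_coeff_bound (a : nat -> C) (n : nat) : convex_coeffs a -> Cmod (a n) <= 1.
Proof.
  intros Ha. destruct n as [|n].
  - destruct Ha as [-> _]. rewrite Cmod_0. lra.
  - assert (B := convex_deriv_coeff_bound a n Ha). unfold CPS_deriv in B.
    assert (Hn := pos_INR n).
    rewrite Cmod_mult, Cmod_R, Rabs_pos_eq in B by apply pos_INR. rewrite S_INR in B. nra.
Qed.

(* The Schwarz lemma for [z f'' / (2 f' + z f'')]. *)
Lemma convex_schwarz (a : nat -> C) (z : C) :
  convex_coeffs a -> unit_disk z ->
  Cmod (CPS (CPS_deriv (CPS_deriv a)) z)
  <= Cmod (2 * CPS (CPS_deriv a) z + z * CPS (CPS_deriv (CPS_deriv a)) z)%C.
Proof.
  intros [_ [_ [Ha Hconv]]] Hz0.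
  set (b := CPS_deriv a) in *. set (c := CPS_deriv b) in *.
  assert (Hb : cauchy_bounded b) by apply cauchy_bounded_deriv, Ha.
  assert (Hc : cauchy_bounded c) by apply cauchy_bounded_deriv, Hb.
  (* The denominator is f' (p + 1), and Re (p + 1) > 0. Multiplied by z, the quotient below becomes
     (p - 1) / (p + 1). *)
  assert (Hden : forall z, unit_disk z -> (2 * CPS b z + z * CPS c z)%C <> RtoC 0).
  { intros w Hw. destruct (Hconv w Hw) as [Hn Hre].
    replace (2 * CPS b w + w * CPS c w)%C with (CPS b w * (1 + w * CPS c w / CPS b w + 1))%C
      by (field; exact Hn).
    apply Cmult_neq_0; [exact Hn|]. apply Re_pos_neq_0. rewrite re_plus, re_RtoC. lra. }
  assert (H : Cmod (CPS c z * / (2 * CPS b z + z * CPS c z))%C <= 1).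
  { apply (hol2_schwarz (fun z => CPS c z * / (2 * CPS b z + z * CPS c z))%C 1);
      [| |exact Hz0].
    - apply hol2_mult; [apply hol2_CPS, Hc|].
      apply (hol2_inv (fun z => 2 * CPS b z + z * CPS c z)%C); [|exact Hden].
      apply hol2_plus.
      + apply (hol2_mult (fun _ => RtoC 2)); [apply hol2_const|apply hol2_CPS, Hb].
      + apply (hol2_mult (fun z => z)); [|apply hol2_CPS, Hc].
        exists (fun _ => RtoC 1), (fun _ => RtoC 0). intros w _.
        split; [apply cderiv_id|apply cderiv_const].
    - intros w Hw. destruct (Hconv w Hw) as [Hn Hre].
      rewrite pow_1, <- Cmod_mult.
      assert (HB := Cayley_bound _ Hre).
      set (p := (1 + w * CPS c w / CPS b w)%C) in *.
      assert (Hp : (p + 1)%C <> RtoC 0).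
      { apply Re_pos_neq_0. rewrite re_plus, re_RtoC. lra. }
      replace (w * (CPS c w * / (2 * CPS b w + w * CPS c w)))%C with ((p - 1) / (p + 1))%C.
      + rewrite Cmod_div by exact Hp. apply Rle_div_l; [apply Cmod_gt_0, Hp|]. lra.
      + unfold p in *. field.
        repeat split; try exact Hn; intros E; apply (Hden w Hw); rewrite <- E; ring. }
  rewrite Cmod_mult, Cmod_inv in H by apply Hden, Hz0.
  assert (Hp := proj1 (Cmod_gt_0 _) (Hden z Hz0)).
  apply (Rmult_le_reg_r (/ Cmod (2 * CPS b z + z * CPS c z)%C)).
  - apply Rinv_0_lt_compat, Hp.
  - rewrite Rinv_r by lra. exact H.
Qed.

(** Squaring and dropping Im v leaves a quadratic inequality in Re v with roots -2 / (1 + t) and 2 /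
    (1 - t). For v = u f''(t u) / f'(t u) this bounds the radial logarithmic derivative of |f'|
    below by that of (1 + t)^(-2). *)
Lemma Re_ge_of_Cmod_le (v : C) (t : R) :
  0 <= t < 1 -> Cmod v <= Cmod (2 + t * v)%C -> - (2 / (1 + t)) <= Re v.
Proof.
  intros Ht H.
  assert (H1 := Cmod2_alt v). assert (H2 := Cmod2_alt (2 + t * v)%C).
  rewrite re_plus, im_plus, re_scal_l, im_scal_l, re_RtoC, im_RtoC in H2.
  assert (H3 : Cmod v ^ 2 <= Cmod (2 + t * v)%C ^ 2).
  { apply pow_incr. split; [apply Cmod_ge_0|exact H]. }
  set (x := Re v) in *. set (y := Im v) in *.
  assert (H4 : (x * (1 + t) + 2) * (x * (1 - t) - 2) <= 0).
  { assert (0 <= y ^ 2 * (1 - t ^ 2)) by (apply Rmult_le_pos; [apply pow2_ge_0|nra]). nra. }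
  apply Rmult_le_reg_r with (1 + t); [lra|].
  replace (- (2 / (1 + t)) * (1 + t)) with (-2) by (field; lra).
  destruct (Rle_lt_dec 0 (x * (1 + t) + 2)) as [Hx|Hx]; [lra|].
  assert (x < 0) by nra. assert (x * (1 - t) - 2 < 0) by nra. nra.
Qed.

(* Along a ray [|f'(t u)|^2 (1 + t)^4] is nondecreasing. *)
Lemma convex_distortion (a : nat -> C) (z : C) :
  convex_coeffs a -> unit_disk z -> 1 <= Cmod (CPS (CPS_deriv a) z) * (1 + Cmod z) ^ 2.
Proof.
  intros Hconv Hz. assert (Hconv' := Hconv). destruct Hconv' as [_ [Ha1 [Ha Hc0]]].
  set (b := CPS_deriv a) in *.
  assert (Hb : cauchy_bounded b) by apply cauchy_bounded_deriv, Ha.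
  set (r := Cmod z) in *. assert (Hr0 : 0 <= r) by apply Cmod_ge_0. unfold unit_disk in Hz.
  fold r in Hz.
  assert (Hu : exists u, Cmod u = 1 /\ z = (r * u)%C).
  { destruct (Ceq_dec z 0) as [E|E].
    - exists (RtoC 1). rewrite Cmod_1. split; [reflexivity|].
      unfold r. rewrite E, Cmod_0. ring.
    - assert (Hr : 0 < r) by (apply Cmod_gt_0, E).
      assert (HrC : RtoC r <> RtoC 0) by (intros E2; apply RtoC_inj in E2; lra).
      exists (z / r)%C. split; [|field; exact HrC].
      rewrite Cmod_div by exact HrC. rewrite Cmod_R, Rabs_pos_eq by exact Hr0.
      unfold r. field. unfold r in Hr. lra. }
  destruct Hu as [u [Hu Ez]].
  set (X := fun t : R => Re (CPS b (0 + t * u) * 1)%C).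
  set (Y := fun t : R => Re (CPS b (0 + t * u) * - Ci)%C).
  set (c := CPS_deriv b).
  set (dX := fun t : R => Re (u * CPS c (0 + t * u) * 1)%C).
  set (dY := fun t : R => Re (u * CPS c (0 + t * u) * - Ci)%C).
  set (L := fun t => (X t ^ 2 + Y t ^ 2) * (1 + t) ^ 4).
  set (dL := fun t => (2 * X t * dX t + 2 * Y t * dY t) * (1 + t) ^ 4
    + (X t ^ 2 + Y t ^ 2) * (4 * (1 + t) ^ 3)).
  assert (Hin : forall t, 0 <= t <= r -> unit_disk (0 + t * u)%C).
  { intros t Ht. unfold unit_disk. rewrite Cplus_0_l, Cmod_mult, Hu, Cmod_R, Rabs_pos_eq; lra. }
  assert (HXY : forall t, X t ^ 2 + Y t ^ 2 = Cmod (CPS b (0 + t * u)%C) ^ 2).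
  { intros t. rewrite Cmod2_alt. unfold X, Y. rewrite Cmult_1_r.
    assert (E : Re (CPS b (0 + t * u) * - Ci)%C = Im (CPS b (0 + t * u)%C)).
    { rewrite re_mult, re_opp, im_opp. simpl. ring. }
    rewrite E. reflexivity. }
  assert (HdL : forall t, 0 <= t <= r -> derivable_pt_lim L t (dL t)).
  { intros t Ht.
    assert (DX : derivable_pt_lim X t (dX t)).
    { apply cderiv_path. apply cderiv_CPS; [exact Hb|apply Hin, Ht]. }
    assert (DY : derivable_pt_lim Y t (dY t)).
    { apply cderiv_path. apply cderiv_CPS; [exact Hb|apply Hin, Ht]. }
    apply is_derive_Reals in DX. apply is_derive_Reals in DY.
    apply is_derive_Reals. unfold L, dL.
    auto_derive.
    - repeat split; try (exists (dX t); exact DX); exists (dY t); exact DY.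
    - replace (Derive (fun x => X x) t) with (dX t) by (symmetry; apply is_derive_unique, DX).
      replace (Derive (fun x => Y x) t) with (dY t) by (symmetry; apply is_derive_unique, DY).
      ring. }
  assert (HdL0 : forall t, 0 <= t <= r -> 0 <= dL t).
  { intros t Ht. assert (Hd := Hin t Ht). destruct (Hc0 _ Hd) as [Hn _].
    assert (HS := convex_schwarz a _ Hconv Hd). fold b c in HS.
    set (F := CPS b (0 + t * u)%C) in *. set (G := CPS c (0 + t * u)%C) in *.
    set (v := (u * G / F)%C).
    assert (Hv : - (2 / (1 + t)) <= Re v).
    { apply Re_ge_of_Cmod_le; [lra|].
      replace (2 + t * v)%C with ((2 * F + (0 + t * u) * G) / F)%C by (unfold v; field; exact Hn).
      unfold v. rewrite !Cmod_div, Cmod_mult, Hu, Rmult_1_l by exact Hn.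
      apply Rmult_le_compat_r; [|exact HS]. apply Rlt_le, Rinv_0_lt_compat, Cmod_gt_0, Hn. }
    (* Along the ray F has derivative u G = v F, so half the derivative of |F|^2 is the real part of
       conj(F) v F. *)
    assert (E : X t * dX t + Y t * dY t = (X t ^ 2 + Y t ^ 2) * Re v).
    { rewrite HXY. fold F. unfold X, Y, dX, dY. fold F G.
      assert (EG : (u * G)%C = (v * F)%C) by (unfold v; field; exact Hn).
      rewrite EG, !Cmult_1_r, Cmod2_alt.
      assert (E : forall w, Re (w * - Ci)%C = Im w).
      { intros w. rewrite re_mult, re_opp, im_opp. simpl. ring. }
      rewrite !E, re_mult, im_mult. ring. }
    unfold dL.
    replace ((2 * X t * dX t + 2 * Y t * dY t) * (1 + t) ^ 4 + (X t ^ 2 + Y t ^ 2) * (4 * (1 + t) ^ 3))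
      with (2 * (X t * dX t + Y t * dY t) * (1 + t) ^ 4 + (X t ^ 2 + Y t ^ 2) * (4 * (1 + t) ^ 3)) by ring.
    rewrite E.
    replace (2 * ((X t ^ 2 + Y t ^ 2) * Re v) * (1 + t) ^ 4 + (X t ^ 2 + Y t ^ 2) * (4 * (1 + t) ^ 3))
      with ((X t ^ 2 + Y t ^ 2) * (2 * (1 + t) ^ 4) * (Re v - - (2 / (1 + t)))) by (field; lra).
    apply Rmult_le_pos; [|lra]. apply Rmult_le_pos.
    - rewrite HXY. apply pow2_ge_0.
    - apply Rmult_le_pos; [lra|]. apply pow_le. lra. }
  assert (HL0 : L 0 = 1).
  { unfold L. rewrite HXY. replace (0 + 0 * u)%C with (RtoC 0) by ring.
    rewrite CPS_0 by exact Hb. unfold b. rewrite CPS_deriv_0 by exact Ha1. rewrite Cmod_1. ring. }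
  assert (HLr : L 0 <= L r).
  { destruct (Req_dec r 0) as [E|E]; [rewrite E; apply Rle_refl|].
    destruct (MVT_cor2 L dL 0 r ltac:(lra) HdL) as [s [Hs1 Hs2]].
    assert (0 <= dL s * (r - 0)) by (apply Rmult_le_pos; [apply HdL0|]; lra). lra. }
  unfold L in HLr at 2. rewrite HL0, HXY in HLr.
  replace (0 + r * u)%C with z in HLr by (rewrite Ez; ring).
  assert (Q := Cmod_ge_0 (CPS b z)). assert (Q2 := pow2_ge_0 (1 + r)).
  apply Rnot_lt_le. intros Hlt.
  assert (0 <= Cmod (CPS b z) * (1 + r) ^ 2) by (apply Rmult_le_pos; assumption).
  replace (Cmod (CPS b z) ^ 2 * (1 + r) ^ 4) with ((Cmod (CPS b z) * (1 + r) ^ 2) ^ 2) in HLr by ring.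
  nra.
Qed.

(** * Covering, growth and coefficient tails *)

(* A minimiser of [|f(z) - w| + s |z| / (1 + |z|)] over [|z| <= s] is interior when [s] is close
   to 1; by the distortion bound a Newton step towards [w] lowers the first term faster than it
   raises the second, so the minimiser must solve [f(z) = w]. *)
Lemma convex_covering (a : nat -> C) (w : C) :
  convex_coeffs a -> Cmod w < 1 / 2 -> exists z, unit_disk z /\ CPS a z = w.
Proof.
  intros Hconv Hw. assert (Hconv' := Hconv). destruct Hconv' as [Ha0 [_ [Ha Hc]]].
  assert (Hw0 := Cmod_ge_0 w).
  (* Close enough to 1 for s^2 / (1 + s) > |w|: the penalty on the circle |z| = s alone then exceeds
     |w|, the value of the functional at 0. *)
  set (s := 1 - (1 - 2 * Cmod w) / 4).
  assert (Hs : 0 < s < 1) by (unfold s; lra).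
  assert (Hsw : Cmod w < s * (s / (1 + s))).
  { apply Rmult_lt_reg_r with (1 + s); [lra|].
    replace (s * (s / (1 + s)) * (1 + s)) with (s * s) by (field; lra). unfold s. nra. }
  destruct (closed_disk_max (fun z => - (Cmod (CPS a z + - w)%C + s * (Cmod z / (1 + Cmod z)))) s)
    as [z0 [Hz0 Hmax]]; [lra| |].
  { intros z Hz.
    apply (continuous_at_continuity (fun x => - x)
      (fun z => Cmod (CPS a z + - w)%C + s * (Cmod z / (1 + Cmod z)))); [reg|].
    apply continuous_at_plus.
    - eapply (cderiv_continuous_Cmod (fun z => CPS a z + - w)%C).
      apply cderiv_plus; [|apply cderiv_const].
      apply cderiv_CPS; [exact Ha|]. unfold unit_disk. lra.
    - apply (continuous_at_continuity (fun x => s * (x / (1 + x))) Cmod).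
      + assert (H := Cmod_ge_0 z). reg. lra.
      + apply (cderiv_continuous_Cmod (fun z => z) z 1), cderiv_id. }
  assert (Hin0 : unit_disk z0) by (unfold unit_disk; lra).
  assert (Hz00 := Cmod_ge_0 z0).
  assert (Hlt : Cmod z0 < s).
  { destruct Hz0 as [Hz0|Hz0]; [exact Hz0|]. exfalso.
    specialize (Hmax (RtoC 0)). cbv beta in Hmax.
    rewrite CPS_0, Ha0, Cmod_0, Hz0 in Hmax by exact Ha.
    replace (0 + - w)%C with (- w)%C in Hmax by ring. rewrite Cmod_opp in Hmax.
    specialize (Hmax ltac:(lra)). assert (Q := Cmod_ge_0 (CPS a z0 + - w)%C).
    replace (0 / (1 + 0)) with 0 in Hmax by field. lra. }
  exists z0. split; [exact Hin0|].
  destruct (Ceq_dec (CPS a z0) w) as [E|E]; [exact E|]. exfalso.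
  set (F := (CPS a z0 - w)%C).
  assert (HF : 0 < Cmod F) by (apply Cmod_gt_0, Cminus_eq_contra, E).
  destruct (Hc z0 Hin0) as [Hl _]. set (l := CPS (CPS_deriv a) z0) in *.
  assert (Hl0 : 0 < Cmod l) by (apply Cmod_gt_0, Hl).
  assert (Hdist := convex_distortion a z0 Hconv Hin0). fold l in Hdist.
  (* The Newton direction: to first order, moving by t d replaces F by (1 - t) F. *)
  set (d := (- F / l)%C).
  assert (Hd : Cmod d = Cmod F / Cmod l) by (unfold d; rewrite Cmod_div, Cmod_opp by exact Hl; reflexivity).
  assert (Hd0 : 0 < Cmod d) by (rewrite Hd; apply Rdiv_lt_0_compat; assumption).
  assert (Hd2 : Cmod d <= Cmod F * (1 + Cmod z0) ^ 2).
  { rewrite Hd. apply Rle_div_l; [exact Hl0|]. nra. }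
  (* The first term drops by t |F| and the penalty rises by at most s t |F|; this eps lets the
     linearisation error use only half of the margin t (1 - s) |F|. *)
  set (eps := (1 - s) * Cmod F / (2 * Cmod d)).
  assert (Heps : 0 < eps) by (apply Rdiv_lt_0_compat; [apply Rmult_lt_0_compat|]; lra).
  destruct (cderiv_CPS a z0 Ha Hin0 eps Heps) as [delta [Hdelta HD]]. fold l in HD.
  set (mu := Rmin (Rmin delta (s - Cmod z0)) (Cmod d)).
  assert (Hmu : 0 < mu) by (repeat apply Rmin_pos; lra).
  assert (M1 := Rmin_l (Rmin delta (s - Cmod z0)) (Cmod d)).
  assert (M2 := Rmin_r (Rmin delta (s - Cmod z0)) (Cmod d)).
  assert (M3 := Rmin_l delta (s - Cmod z0)). assert (M4 := Rmin_r delta (s - Cmod z0)).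
  fold mu in M1, M2.
  set (t := mu / (2 * Cmod d)).
  assert (Ht : 0 < t) by (apply Rdiv_lt_0_compat; lra).
  assert (Htd : t * Cmod d = mu / 2) by (unfold t; field; lra).
  assert (Ht1 : t <= 1).
  { unfold t. apply Rle_div_l; lra. }
  assert (Hctd : Cmod (t * d)%C = t * Cmod d) by (rewrite Cmod_mult, Cmod_R, Rabs_pos_eq; lra).
  specialize (HD (z0 + t * d)%C).
  replace (z0 + t * d - z0)%C with (t * d)%C in HD by ring.
  rewrite Hctd in HD. specialize (HD ltac:(lra)).
  assert (Hnorm : Cmod (z0 + t * d)%C <= Cmod z0 + t * Cmod d).
  { eapply Rle_trans; [apply Cmod_triangle|]. lra. }
  specialize (Hmax (z0 + t * d)%C ltac:(lra)). cbv beta in Hmax.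
  assert (T1 : Cmod (CPS a (z0 + t * d) + - w)%C <= (1 - t) * Cmod F + eps * (t * Cmod d)).
  { replace (CPS a (z0 + t * d) + - w)%C
      with ((1 - t)%R * F + (CPS a (z0 + t * d) - CPS a z0 - t * d * l))%C.
    - eapply Rle_trans; [apply Cmod_triangle|].
      rewrite Cmod_mult, Cmod_R, Rabs_pos_eq by lra. lra.
    - rewrite RtoC_minus. unfold d, F. field. exact Hl. }
  (* The function x / (1 + x) is concave with slope (1 + x)^(-2), and the step has length at most t
     |F| (1 + |z0|)^2 by the distortion bound. *)
  assert (T2 : Cmod (z0 + t * d)%C / (1 + Cmod (z0 + t * d)%C)
    <= Cmod z0 / (1 + Cmod z0) + t * Cmod F).
  { set (x := Cmod z0) in *. set (y := Cmod (z0 + t * d)%C) in *.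
    assert (Hy : 0 <= y) by apply Cmod_ge_0.
    apply Rle_div_l; [lra|].
    assert (Hx2 : y - x <= t * Cmod F * (1 + x) ^ 2).
    { apply (Rmult_le_compat_l t) in Hd2; lra. }
    apply Rmult_le_reg_r with (1 + x); [lra|].
    replace ((x / (1 + x) + t * Cmod F) * (1 + y) * (1 + x))
      with ((x + t * Cmod F * (1 + x)) * (1 + y)) by (field; lra).
    assert (HtF : 0 < t * Cmod F) by (apply Rmult_lt_0_compat; assumption).
    set (k := t * Cmod F) in *. clearbody k.
    destruct (Rle_lt_dec y x) as [Hyx|Hyx].
    - assert (0 <= k * (1 + x) * (1 + y)) by (repeat apply Rmult_le_pos; lra). nra.
    - assert (k * (1 + x) * (1 + x) <= k * (1 + x) * (1 + y)).
      { apply Rmult_le_compat_l; [apply Rmult_le_pos; lra|lra]. }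
      nra. }
  assert (T3 : eps * (t * Cmod d) = t * ((1 - s) * Cmod F / 2)) by (unfold eps; field; lra).
  rewrite T3 in T1. change (CPS a z0 + - w)%C with F in Hmax.
  apply (Rmult_le_compat_l s) in T2; [|lra].
  assert (0 < t * ((1 - s) * Cmod F)) 
    by (apply Rmult_lt_0_compat; [exact Ht|apply Rmult_lt_0_compat; lra]).
  nra.
Qed.

(** A boundary point of modulus below 1/2 would have a neighbour outside the image that is also of
    modulus below 1/2, against the covering result. *)
Lemma convex_boundary_ge (f : C -> C) (a : nat -> C) (w : C) :
  convex_class f a -> boundary (image f unit_disk) w -> 1 / 2 <= Cmod w.
Proof.
  intros Hf Hb. destruct (convex_class_coeffs f a Hf) as [Ha Ef].
  apply Rnot_lt_le. intros Hlt.
  destruct (Hb (1 / 2 - Cmod w) ltac:(lra)) as [_ [v [Hv1 Hv2]]].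
  destruct (convex_covering a v Ha) as [z [Hz Ez]].
  { assert (H := Cmod_minus_ge v w). lra. }
  apply Hv1. exists z. split; [exact Hz|]. rewrite Ef by exact Hz. exact Ez.
Qed.

Lemma convex_growth (f : C -> C) (a : nat -> C) (z : C) :
  convex_class f a -> unit_disk z -> Cmod (f z) <= Cmod z / (1 - Cmod z).
Proof.
  intros Hf Hz. destruct (convex_class_coeffs f a Hf) as [Ha Ef].
  rewrite Ef by exact Hz. assert (Ha' := Ha). destruct Ha' as [Ha0 [_ [Hg _]]].
  rewrite CPS_shift, Ha0, Cplus_0_l, Cmod_mult by assumption.
  apply Rmult_le_compat_l; [apply Cmod_ge_0|].
  eapply is_series_Cmod_le; [apply CPS_correct; [apply (cauchy_bounded_shift _ Hg)|exact Hz]| |].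
  - apply (is_series_geom (Cmod z)). rewrite Rabs_pos_eq by apply Cmod_ge_0. exact Hz.
  - intros n. cbv beta. rewrite Cmod_mult, Cmod_pow.
    assert (H1 := convex_coeff_bound a (S n) Ha).
    assert (H2 := pow_le (Cmod z) n (Cmod_ge_0 z)). nra.
Qed.

Lemma Series_geom_tail (N : nat) (r : R) :
  0 <= r < 1 -> is_series (fun k => r ^ (N + k)) (r ^ N / (1 - r)).
Proof.
  intros Hr. apply (@is_series_ext R_AbsRing R_NormedModule (fun k => r ^ N * r ^ k)).
  - intros k. symmetry. apply pow_add.
  - apply (@is_series_scal_l R_AbsRing R_NormedModule (r ^ N) (fun k => r ^ k)).
    apply is_series_geom. rewrite Rabs_pos_eq; lra.
Qed.

Lemma convex_coef_tail_le (a : nat -> C) (N : nat) (r : R) :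
  convex_coeffs a -> 0 <= r < 1 -> coef_tail a N r <= r ^ N / (1 - r).
Proof.
  intros Ha Hr. unfold coef_tail.
  rewrite <- (is_series_unique _ _ (Series_geom_tail N r Hr)).
  apply Series_le; [|eexists; apply Series_geom_tail, Hr].
  intros k. assert (H1 := convex_coeff_bound a (N + k) Ha).
  assert (H2 := pow_le r (N + k) (proj1 Hr)).
  assert (H3 := Cmod_ge_0 (a (N + k)%nat)). nra.
Qed.

(** * The radius equation *)

(** The quotient is replaced by its geometric sum, which makes sense at r = 1: the intermediate
    value theorem can use the endpoint 1, and monotonicity excludes roots beyond it. The [pred m]
    occurs because [sum_f_R0] includes its upper index. *)
Definition radius_poly (m N : nat) (r : R) : R :=
  3 * r ^ m - 1 + 2 * r ^ N * sum_f_R0 (pow r) (pred m).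

Lemma radius_poly_eq (m N : nat) (r : R) :
  (1 <= m)%nat -> r <> 1 ->
  radius_poly m N r = 3 * r ^ m - 1 + 2 * r ^ N * ((1 - r ^ m) / (1 - r)).
Proof.
  intros Hm Hr. unfold radius_poly. rewrite tech3 by exact Hr.
  replace (S (pred m)) with m by lia. reflexivity.
Qed.

Lemma radius_poly_increasing (m N : nat) (x y : R) :
  (1 <= m)%nat -> 0 <= x < y -> radius_poly m N x < radius_poly m N y.
Proof.
  intros Hm Hxy. unfold radius_poly.
  assert (H1 : x ^ m < y ^ m).
  { destruct m as [|m]; [lia|]. simpl. assert (x ^ m <= y ^ m) by (apply pow_incr; lra).
    assert (0 <= x ^ m) by (apply pow_le; lra). assert (0 < y ^ m) by (apply pow_lt; lra). nra. }
  assert (H2 : x ^ N * sum_f_R0 (pow x) (pred m) <= y ^ N * sum_f_R0 (pow y) (pred m)).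
  { apply Rmult_le_compat.
    - apply pow_le; lra.
    - apply cond_pos_sum. intros k. apply pow_le. lra.
    - apply pow_incr. lra.
    - apply sum_Rle. intros k _. apply pow_incr. lra. }
  lra.
Qed.

Lemma radius_poly_continuity (m N : nat) : continuity (radius_poly m N).
Proof.
  unfold radius_poly. apply continuity_plus; [reg|]. apply continuity_mult; [reg|].
  intros x. induction (pred m) as [|k IH]; simpl sum_f_R0.
  - apply continuity_pt_const. intros u v. reflexivity.
  - apply (continuity_pt_plus (fun r => sum_f_R0 (pow r) k) (fun r => r ^ S k)); [exact IH|reg].
Qed.

Lemma radius_poly_root (m N : nat) :
  (1 <= m)%nat -> (1 <= N)%nat -> exists r, 0 < r < 1 /\ radius_poly m N r = 0.
Proof.
  intros Hm HN.
  assert (E0 : radius_poly m N 0 = -1).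
  { unfold radius_poly. rewrite !pow_i by lia. ring. }
  assert (E1 : 0 < radius_poly m N 1).
  { unfold radius_poly. rewrite !pow1.
    assert (0 <= sum_f_R0 (pow 1) (pred m)); [|lra].
    apply cond_pos_sum. intros k. rewrite pow1. lra. }
  destruct (IVT (radius_poly m N) 0 1 (radius_poly_continuity m N)) as [r [Hr E]]; try lra.
  exists r. split; [|exact E].
  split; apply Rnot_le_lt; intros H.
  - assert (r = 0) by lra. subst r. lra.
  - assert (r = 1) by lra. subst r. lra.
Qed.

Lemma radius_equation_poly (m N : nat) (r : R) :
  (1 <= m)%nat -> radius_equation m N r <-> r <> 1 /\ radius_poly m N r = 0.
Proof.
  intros Hm. unfold radius_equation. split.
  - intros H. assert (Hr : r <> 1).
    { intros ->. rewrite !pow1 in H. unfold Rdiv in H. rewrite Rminus_diag, Rmult_0_l in H. lra. }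
    split; [exact Hr|]. rewrite radius_poly_eq; assumption.
  - intros [Hr H]. rewrite radius_poly_eq in H; assumption.
Qed.

(** An exact identity rather than an estimate, so it serves both the validity of the radius and its
    sharpness. *)
Lemma majorant_radius_poly (m N : nat) (r : R) :
  (1 <= m)%nat -> 0 <= r < 1 -> 0 < 1 - r ^ m /\
  r ^ m / (1 - r ^ m) + r ^ N / (1 - r) = 1 / 2 + radius_poly m N r / (2 * (1 - r ^ m)).
Proof.
  intros Hm Hr.
  assert (Hp : r ^ m < 1).
  { destruct m as [|m]; [lia|]. simpl.
    assert (0 <= r ^ m <= 1) by (split; [apply pow_le; lra|rewrite <- (pow1 m); apply pow_incr; lra]).
    nra. }
  split; [lra|]. rewrite radius_poly_eq by (assumption || lra). field. lra.
Qed.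

(** * The extremal function z / (1 - z) *)

Definition half_plane_map (z : C) : C := (z * / (1 - z))%C.

Definition half_plane_coeffs (n : nat) : C := match n with O => RtoC 0 | S _ => RtoC 1 end.

Lemma one_minus_neq_0 (z : C) : unit_disk z -> (1 - z)%C <> RtoC 0.
Proof.
  intros Hz E. apply Ceq_minus in E. unfold unit_disk in Hz. rewrite <- E, Cmod_1 in Hz. lra.
Qed.

Lemma half_plane_pseries (z : C) :
  unit_disk z -> @is_pseries C_AbsRing C_NormedModule half_plane_coeffs z (half_plane_map z).
Proof.
  intros Hz.
  assert (H1 : cauchy_bounded (fun _ => RtoC 1)).
  { intros r Hr. exists 1. intros n. rewrite Cmod_1, Rmult_1_l, <- (pow1 n).
    apply pow_incr. lra. }
  assert (H : cauchy_bounded half_plane_coeffs).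
  { intros r Hr. exists 1. intros n. apply Rle_trans with (1 * 1); [|lra].
    apply Rmult_le_compat; [apply Cmod_ge_0|apply pow_le; lra| |].
    - destruct n; simpl half_plane_coeffs; [rewrite Cmod_0|rewrite Cmod_1]; lra.
    - rewrite <- (pow1 n). apply pow_incr. lra. }
  (* For the series with all coefficients 1 the shift reads G = 1 + z G, which determines G. *)
  assert (E1 := CPS_shift (fun _ => RtoC 1) z H1 Hz).
  assert (E := CPS_shift half_plane_coeffs z H Hz). simpl in E.
  set (G := CPS (fun _ => RtoC 1) z) in *.
  assert (EG : G = (/ (1 - z))%C).
  { assert (Hn := one_minus_neq_0 z Hz).
    assert (E2 : ((1 - z) * G)%C = RtoC 1).
    { replace ((1 - z) * G)%C with (G - z * G)%C by ring. rewrite E1 at 1. ring. }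
    replace G with ((1 - z) * G / (1 - z))%C by (field; exact Hn). rewrite E2. field. exact Hn. }
  replace (half_plane_map z) with (CPS half_plane_coeffs z).
  - apply (proj2 (is_pseries_C _ _ _)). apply CPS_correct; assumption.
  - rewrite E, EG. unfold half_plane_map. ring.
Qed.

Lemma half_plane_convex : convex_class half_plane_map half_plane_coeffs.
Proof.
  split; [reflexivity|]. split; [reflexivity|]. split; [exact half_plane_pseries|].
  (* This function satisfies u' = u^2, so z u has derivative u + z u^2 = u^2, and the second
     derivative is 2 u^3. *)
  set (u := fun z => (/ (1 - z))%C).
  exists (fun z => u z * u z)%C, (fun z => 2 * (u z * u z * u z))%C.
  intros z Hz. assert (Hn := one_minus_neq_0 z Hz).
  assert (Du : cderiv u z (u z * u z)%C).
  { replace (u z * u z)%C with (- (0 + - (1)) / ((1 - z) * (1 - z)))%C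
      by (unfold u; field; exact Hn).
    apply (cderiv_inv (fun z => 1 - z)%C); [|exact Hn].
    apply (cderiv_plus (fun _ => RtoC 1) (fun z => - z)%C); [apply cderiv_const|].
    apply (cderiv_ext_loc (fun w => (- (1)) * w)%C _ _ _ 1); [lra| |apply cderiv_scal_id].
    intros w _. ring. }
  split; [|split; [|split]].
  - apply is_derive_cderiv.
    replace (u z * u z)%C with (1 * u z + z * (u z * u z))%C by (unfold u; field; exact Hn).
    apply (cderiv_mult (fun z => z) u); [apply cderiv_id|exact Du].
  - apply is_derive_cderiv.
    replace (2 * (u z * u z * u z))%C with (u z * u z * u z + u z * (u z * u z))%C by ring.
    apply (cderiv_mult u u); exact Du.
  - assert (Hu : u z <> RtoC 0).
    { intros E. apply C1_nz. replace (RtoC 1) with ((1 - z) * u z)%C by (unfold u; field; exact Hn).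
      rewrite E. ring. }
    apply Cmult_neq_0; exact Hu.
  - set (w := (1 + z * (2 * (u z * u z * u z)) / (u z * u z))%C).
    assert (E : (w * (1 - z))%C = (1 + z)%C) by (unfold w, u; field; exact Hn).
    assert (ER := f_equal Re E). assert (EI := f_equal Im E).
    assert (HM := Cmod2_alt z). assert (HZ0 := Cmod_ge_0 z). unfold unit_disk in Hz.
    clearbody w. destruct w as [p q], z as [x y]. simpl in *.
    assert (0 < 1 - x ^ 2 - y ^ 2) by nra.
    (* This combination of the real and imaginary parts of w (1 - z) = 1 + z eliminates Im w and
       leaves Re w |1 - z|^2 = 1 - |z|^2. *)
    apply (f_equal (fun t => t * (1 - x))) in ER. apply (f_equal (fun t => t * y)) in EI.
    assert (p * ((1 - x) ^ 2 + y ^ 2) = 1 - x ^ 2 - y ^ 2) by lra.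
    apply Rnot_le_lt. intros Hp.
    assert (0 <= (1 - x) ^ 2 + y ^ 2) by nra. nra.
Qed.

Lemma half_plane_boundary : boundary (image half_plane_map unit_disk) (RtoC (- (1 / 2))).
Proof.
  intros eps He. split.
  - set (d := Rmin eps 1 / 2).
    assert (Hm : 0 < Rmin eps 1) by (apply Rmin_pos; lra).
    assert (M1 := Rmin_l eps 1). assert (M2 := Rmin_r eps 1).
    assert (Hd : 0 < d <= 1 / 2 /\ d < eps) by (unfold d; lra).
    exists (RtoC (- (1 / 2) + d)). split.
    (* The preimage of w under the map is w / (1 + w), taken at w = d - 1/2. *)
    + exists (RtoC ((d - 1 / 2) / (d + 1 / 2))). split.
      * unfold unit_disk. rewrite Cmod_R. apply Rabs_def1.
        -- apply Rlt_div_l; lra.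
        -- apply Rlt_div_r; lra.
      * unfold half_plane_map.
        rewrite <- RtoC_minus, <- RtoC_inv, <- RtoC_mult.
        -- f_equal. field. lra.
        -- replace (1 - (d - 1 / 2) / (d + 1 / 2)) with (1 / (d + 1 / 2)) by (field; lra).
           apply Rgt_not_eq, Rdiv_lt_0_compat; lra.
    + rewrite <- RtoC_minus, Cmod_R. apply Rabs_def1; lra.
  (* The point -1/2 itself lies outside the image: its only preimage would be z = -1. *)
  - exists (RtoC (- (1 / 2))). split.
    + intros [z [Hz E]]. unfold half_plane_map in E.
      assert (Hn := one_minus_neq_0 z Hz).
      assert (E2 : (z * / (1 - z) * (1 - z))%C = z) by (field; exact Hn).
      rewrite E in E2. unfold unit_disk in Hz.
      assert (ER := f_equal Re E2). assert (EI := f_equal Im E2).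
      assert (HM := Cmod2_alt z). assert (HZ0 := Cmod_ge_0 z).
      destruct z as [x y]. simpl in *.
      assert (x = -1) by lra. subst x. nra.
    + rewrite <- RtoC_minus, Rminus_diag, Cmod_0. exact He.
Qed.

(** * Validity of the radius and its sharpness *)

Lemma bohr_inequality_of_radius_poly (m N : nat) (f : C -> C) (a : nat -> C) (z : C) :
  (1 <= m)%nat -> convex_class f a -> unit_disk z -> radius_poly m N (Cmod z) <= 0 ->
  bohr_inequality m N f a z.
Proof.
  intros Hm Hf Hz HP. unfold unit_disk in Hz. assert (Hz0 := Cmod_ge_0 z).
  destruct (majorant_radius_poly m N (Cmod z) Hm ltac:(lra)) as [Hp E].
  assert (Hgrowth := convex_growth f a (z ^ m)%C Hf).
  rewrite Cmod_pow in Hgrowth. unfold unit_disk in Hgrowth. rewrite Cmod_pow in Hgrowth.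
  specialize (Hgrowth ltac:(lra)).
  assert (Htail := convex_coef_tail_le a N (Cmod z) (proj1 (convex_class_coeffs f a Hf)) ltac:(lra)).
  assert (Hle : radius_poly m N (Cmod z) / (2 * (1 - Cmod z ^ m)) <= 0).
  { apply Rle_div_l; lra. }
  unfold bohr_inequality, dist_to_set.
  (* Only the greatest-lower-bound property is used, so an empty boundary, at distance [p_infty], is
     covered too. *)
  match goal with |- Rbar_le _ (Glb_Rbar ?E) => apply (Glb_Rbar_correct E) end.
  intros x [w [Hw ->]].
  assert (B := convex_boundary_ge f a w Hf Hw).
  replace (w - 0)%C with w by ring. simpl. lra.
Qed.

Lemma half_plane_bohr_fails (m N : nat) (r : R) :
  (1 <= m)%nat -> (1 <= N)%nat -> 0 < r < 1 -> 0 < radius_poly m N r ->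
  ~ bohr_inequality m N half_plane_map half_plane_coeffs (RtoC r).
Proof.
  intros Hm HN Hr HP H.
  destruct (majorant_radius_poly m N r Hm ltac:(lra)) as [Hp E].
  assert (Hd : Rbar_le (dist_to_set (RtoC 0) (boundary (image half_plane_map unit_disk))) (1 / 2)).
  { unfold dist_to_set.
    match goal with |- Rbar_le (Glb_Rbar ?E) _ => apply (proj1 (Glb_Rbar_correct E)) end.
    exists (RtoC (- (1 / 2))). split; [apply half_plane_boundary|].
    rewrite <- RtoC_minus, Cmod_R, Rminus_0_r, Rabs_Ropp, Rabs_pos_eq; lra. }
  unfold bohr_inequality in H. assert (H2 := Rbar_le_trans _ _ _ H Hd). simpl in H2.
  assert (Er : Cmod (RtoC r) = r) by (rewrite Cmod_R, Rabs_pos_eq; lra).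
  assert (Hrm : 0 < r ^ m) by (apply pow_lt; lra).
  assert (Ef : Cmod (half_plane_map (r ^ m)%C) = r ^ m / (1 - r ^ m)).
  { unfold half_plane_map. rewrite <- RtoC_pow, <- RtoC_minus, <- RtoC_inv, <- RtoC_mult by lra.
    rewrite Cmod_R. apply Rabs_pos_eq, Rlt_le, Rdiv_lt_0_compat; lra. }
  assert (Et : coef_tail half_plane_coeffs N r = r ^ N / (1 - r)).
  { unfold coef_tail. apply is_series_unique.
    apply (@is_series_ext R_AbsRing R_NormedModule (fun k => r ^ (N + k))).
    (* Since N >= 1, the tail avoids index 0, the only index whose coefficient is not 1. *)
    - intros k. destruct N as [|N]; [lia|]. simpl half_plane_coeffs.
      rewrite Cmod_1. symmetry. apply Rmult_1_l.
    - apply Series_geom_tail. lra. }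
  rewrite Er, Ef, Et, E in H2.
  assert (0 < radius_poly m N r / (2 * (1 - r ^ m))) by (apply Rdiv_lt_0_compat; lra).
  lra.
Qed.

Theorem corollary2p14 (m N : nat) (hm : (1 <= m)%nat) (hN : (1 <= N)%nat) :
  exists r0 : R,
    unique (fun r : R => 0 < r /\ radius_equation m N r) r0 /\
    bohr_holds_up_to m N r0 /\
    (forall r1 : R, r0 < r1 -> ~ bohr_holds_up_to m N r1).
Proof.
  destruct (radius_poly_root m N hm hN) as [r0 [Hr0 E0]].
  assert (Hmono := fun x y => radius_poly_increasing m N x y hm).
  exists r0. split; [split|split].
  - split; [lra|]. apply radius_equation_poly; [exact hm|]. split; [lra|exact E0].
  - intros r [Hr Er]. apply radius_equation_poly in Er; [|exact hm]. destruct Er as [_ Er].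
    destruct (Rtotal_order r0 r) as [H|[H|H]]; [|exact H|].
    + specialize (Hmono r0 r ltac:(lra)). lra.
    + specialize (Hmono r r0 ltac:(lra)). lra.
  - intros f a Hf z Hz Hzr. apply bohr_inequality_of_radius_poly; try assumption.
    assert (Hz0 := Cmod_ge_0 z).
    destruct Hzr as [Hzr|Hzr]; [|rewrite Hzr, E0; lra].
    specialize (Hmono (Cmod z) r0 ltac:(lra)). lra.
  - intros r1 Hr1 H.
    (* Capping [r1] at 1 keeps the test point inside the disk, since [r1] itself may exceed 1. *)
    set (r := (r0 + Rmin r1 1) / 2).
    assert (M1 := Rmin_l r1 1). assert (M2 := Rmin_r r1 1).
    assert (Hm : r0 < Rmin r1 1) by (apply Rmin_glb_lt; lra).
    assert (Hr : r0 < r < 1) by (unfold r; lra).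
    specialize (Hmono r0 r ltac:(lra)).
    assert (Er : Cmod (RtoC r) = r) by (rewrite Cmod_R, Rabs_pos_eq; lra).
    apply (half_plane_bohr_fails m N r hm hN); [lra|lra|].
    apply H; [exact half_plane_convex|unfold unit_disk; lra|rewrite Er; unfold r; lra].
Qed.
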